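(* There are constants $C,c>0$, independent of $N$ and $k$, such that for all $N\ge2$, all $k\in\{1,\ldots,N-1\}$ with $\bar x=(k-\tfrac12)p\ell^2/R$, and all $n\in\mathbb{N}_0$, $$P_N\bigl(|K(\bar x;z_1,\ldots,z_N)|\ge n\bigr)\le C\exp(-cn^3).$$
   Context: Setting. Let $R,\ell>0$ and $p\in\mathbb{N}$. $\mathcal{Z}=\mathbb{R}\times[0,2\pi R]$, with $z=x+iy$. Laughlin's function. $$\Psi_N(z_1,\ldots,z_N)=\kappa_N\prod_{j<k}\bigl(e^{z_k/R}-e^{z_j/R}\bigr)^p\exp\Bigl(-\frac{1}{2\ell^2}\sum_k x_k^2\Bigr),$$ with $\kappa_N>0$. Probability measure. $P_N$ is the probability measure on $\mathcal{Z}^N$ with density proportional to $|\Psi_N|^2$. Particle excess function. For $\bar x=(k-\tfrac12)p\ell^2/R$, $$K(\bar x;z_1,\ldots,z_N)=\#\{j:x_j\le\bar x\}-k .$$ *)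

(* Defs.v *)
From HB Require Import structures.
From mathcomp Require Import all_boot all_order all_algebra.
From mathcomp Require Import all_classical all_reals all_analysis.
Set Implicit Arguments. Unset Strict Implicit. Unset Printing Implicit Defensive.
Import Order.TTheory GRing.Theory Num.Theory.
Import numFieldNormedType.Exports.
Local Open Scope classical_set_scope.
Local Open Scope ring_scope.

Section Laughlin.
Variable R : realType.

(* A point z = x + i y of the cylinder Z = R x [0, 2 pi Rad] is the pair (x, y).
   A configuration (z_1, ..., z_N) is a sequence of N such pairs. *)

Fixpoint cyl_int (Rad : R) (n : nat) (f : seq (R * R) -> \bar R) : \bar R :=
  match n with
  | 0 => f [::]
  | n'.+1 =>
      (\int[lebesgue_measure]_(x in [set: R])
        \int[lebesgue_measure]_(y in [set y : R | (0 <= y <= 2 * pi * Rad)%R])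
          cyl_int Rad n' (fun v => f ((x, y) :: v)))%E
  end.

Definition ez_re (Rad : R) (z : R * R) : R := expR (z.1 / Rad) * cos (z.2 / Rad).
Definition ez_im (Rad : R) (z : R * R) : R := expR (z.1 / Rad) * sin (z.2 / Rad).

Definition sqmod_diff (Rad : R) (zj zk : R * R) : R :=
  (ez_re Rad zk - ez_re Rad zj) ^+ 2 + (ez_im Rad zk - ez_im Rad zj) ^+ 2.

(* |Psi_N(z)|^2 / kappa_N^2  (the normalization constant cancels in P_N) *)
Definition laughlin_sq (Rad ell : R) (p : nat) (z : seq (R * R)) : R :=
  (\prod_(j < size z) \prod_(k < size z | (j < k)%N)
      sqmod_diff Rad (nth (0, 0) z j) (nth (0, 0) z k) ^+ p)
  * expR (- (\sum_(j < size z) (nth (0, 0) z j).1 ^+ 2) / ell ^+ 2).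

Definition PN (Rad ell : R) (p N : nat) (E : seq (R * R) -> bool) : R :=
  fine (cyl_int Rad N (fun z => ((E z)%:R * laughlin_sq Rad ell p z)%:E))
  / fine (cyl_int Rad N (fun z => (laughlin_sq Rad ell p z)%:E)).

Definition xbar (Rad ell : R) (p k : nat) : R :=
  (k%:R - 2^-1) * p%:R * ell ^+ 2 / Rad.

Definition Kexcess (xb : R) (k : nat) (z : seq (R * R)) : int :=
  (count (fun w : R * R => w.1 <= xb) z)%:Z - k%:Z.

End Laughlin.

(* Main.v *)
(** The sites [t_j = (j - 1/2) a], [a = p ell^2 / Rad], cut the cylinder into cells, the cell
[c] being centred at [c a].  Up to short-range terms, a particle with [L] others on its left
sees the harmonic well [(x - L a)^2 / ell^2].  If the excess at [t_k] is [t > 0], then the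
last particle left of [t_k] has [L = k + t - 1], hence sits at distance at least [(t - 1/2) a]
from the centre of its well; moving it there gains a factor [exp(- rate t^2)] and lowers the
excess by one.  If the excess is [- t], one moves the first particle right of [t_k].

Two ideas control the short-range terms.  At the new position one averages over the angle:
[|e^z - e^w|^2] is the square of the larger modulus times [|1 - b e^{iy/Rad}|^2], and a
polynomial with constant term 1 has mean square at least 1 on the circle (Landau).  At the old
position they cost the exponential of the number of particles nearby, which is linear in [s]
and in the distance to [t_k] as long as the excess at every site [t_i] is at most
[s + |i - k|].  Such a [k] is found by maximising the excess minus the distance to the given
site, and a move raises [s] by one only.  After [t] moves the gain is [exp(- rate t^3 / 3)]
against a loss [exp(O(t (s + t)))] with [s = t]; a union bound over the maximising sites
concludes. *)

Require Import Defs.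
From HB Require Import structures.
From mathcomp Require Import all_boot all_order all_algebra.
From mathcomp Require Import all_classical all_reals all_analysis.
From mathcomp Require Import measurable_realfun ring lra zify complex.
Import Order.TTheory GRing.Theory Num.Theory.
Import numFieldNormedType.Exports.
Local Open Scope classical_set_scope.
Local Open Scope ring_scope.
Set Implicit Arguments. Unset Strict Implicit. Unset Printing Implicit Defensive.

(** * Product measures on tuples *)

Section TupleRem.
Variable T : Type.

Definition cons_tuple n (w : T * n.-tuple T) : n.+1.-tuple T := [tuple of w.1 :: w.2].

Definition tuple_rem n (j : 'I_n.+1) (u : n.+1.-tuple T) : n.-tuple T :=
  [tuple tnth u (lift j i) | i < n].

Lemma tuple_rem0_cons n (w : T * n.-tuple T) : tuple_rem ord0 (cons_tuple w) = w.2.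
Proof. by apply: eq_from_tnth => i; rewrite tnth_mktuple tnthS. Qed.

Lemma tuple_rem_cons n (j : 'I_n.+1) z (u : n.+1.-tuple T) :
  tuple_rem (lift ord0 j) (cons_tuple (z, u)) = cons_tuple (z, tuple_rem j u).
Proof.
apply: eq_from_tnth => i; rewrite tnth_mktuple.
have [i' ->|->] := unliftP ord0 i; last by rewrite tnth0 (_ : lift _ _ = ord0)//; exact: val_inj.
rewrite tnthS tnth_mktuple (_ : lift _ _ = lift ord0 (lift j i')) ?tnthS//.
by apply: val_inj; rewrite /= /bump; lia.
Qed.

End TupleRem.

Lemma perm_tuple_rem (T : eqType) n (j : 'I_n.+1) (u : n.+1.-tuple T) :
  perm_eq u (tnth u j :: tuple_rem j u).
Proof.
have -> : tnth u j :: tuple_rem j u = map (tnth u) (j :: map (lift j) (enum 'I_n)).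
  by rewrite /= -map_comp.
rewrite -[X in perm_eq X _]map_tnth_enum; apply/perm_map/uniq_perm => [||i].
- exact: enum_uniq.
- rewrite /= (map_inj_uniq lift_inj) enum_uniq andbT; apply/mapP => -[i _ /eqP].
  by rewrite (negbTE (neq_lift j i)).
- rewrite mem_enum in_cons; have [i' ->|->] := unliftP j i; last by rewrite eqxx.
  by rewrite map_f ?orbT// mem_enum.
Qed.

Section TupleMeasurability.
Context d (T : measurableType d).

Lemma measurable_cons_tuple n : measurable_fun setT (@cons_tuple T n).
Proof. exact: measurable_cons. Qed.

Lemma measurable_tuple_rem n (j : 'I_n.+1) : measurable_fun setT (@tuple_rem T n j).
Proof.
apply/measurable_fun_tnthP => i; rewrite (_ : _ \o _ = fun u => tnth u (lift j i)).
  exact: measurable_tnth.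
by apply/funext => u /=; rewrite tnth_mktuple.
Qed.

Lemma measurable_uncons_tuple n :
  measurable_fun setT (fun u : n.+1.-tuple T => (tnth u ord0, tuple_rem ord0 u)).
Proof. by apply: measurable_fun_pair; [exact: measurable_tnth|exact: measurable_tuple_rem]. Qed.

Lemma cons_tupleK n : cancel (@cons_tuple T n) (fun u => (tnth u ord0, tuple_rem ord0 u)).
Proof. by move=> [z v]; rewrite tnth0 tuple_rem0_cons. Qed.

End TupleMeasurability.

(* An alias of [m1 \x m2], on which the library infers a sigma-finite measure
   only when [m1] and [m2] are probabilities. *)
Section SigmaFiniteProduct.
Context d1 d2 (T1 : measurableType d1) (T2 : measurableType d2) (R : realType).
Variables (m1 : {sigma_finite_measure set T1 -> \bar R}).
Variables (m2 : {sigma_finite_measure set T2 -> \bar R}).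
Local Open Scope ereal_scope.

Definition sigma_finite_product := m1 \x m2.

HB.instance Definition _ := Measure.on sigma_finite_product.

Let sigma_finite_productT : sigma_finite setT sigma_finite_product.
Proof.
have /sigma_finiteP[F [TF ndF Foo]] := sigma_finiteT m1.
have /sigma_finiteP[G [TG ndG Goo]] := sigma_finiteT m2.
exists (fun n => F n `*` G n).
  apply/esym; rewrite -subTset => -[x y] _.
  have : [set: T1] x by []; rewrite TF => -[i _ Fx].
  have : [set: T2] y by []; rewrite TG => -[j _ Gy].
  exists (maxn i j) => //; split => /=.
    by move: x Fx; exact/subsetPset/ndF/leq_maxl.
  by move: y Gy; exact/subsetPset/ndG/leq_maxr.
move=> n; have [[mF Fn] [mG Gn]] := (Foo n, Goo n); split; first exact: measurableX.
by rewrite /sigma_finite_product product_measure1E// lte_mul_pinfty// ge0_fin_numE.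
Qed.

HB.instance Definition _ := Measure_isSigmaFinite.Build _ _ _ sigma_finite_product
  sigma_finite_productT.

End SigmaFiniteProduct.

Section TupleMeasure.
Context d (T : measurableType d) (R : realType).
Local Open Scope ereal_scope.

Section ConsMeasure.
Variables (m : {sigma_finite_measure set T -> \bar R}) (n : nat).
Variable mn : {sigma_finite_measure set (n.-tuple T) -> \bar R}.

Definition cons_measure := pushforward (sigma_finite_product m mn) (@cons_tuple T n).

Let cons_measure0 : cons_measure set0 = 0.
Proof. by rewrite /cons_measure /pushforward preimage_set0 measure0. Qed.

Let cons_measure_ge0 A : 0 <= cons_measure A.
Proof. by rewrite /cons_measure /pushforward measure_ge0. Qed.

Let cons_measure_sigma_additive : semi_sigma_additive cons_measure.
Proof.
have mcons := @measurable_cons_tuple _ T n.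
exact: (@measure_semi_sigma_additive _ _ _ (pushforward (sigma_finite_product m mn) _)).
Qed.

HB.instance Definition _ := isMeasure.Build _ _ _ cons_measure
  cons_measure0 cons_measure_ge0 cons_measure_sigma_additive.

Let cons_measure_sigma_finite : sigma_finite setT cons_measure.
Proof.
have [F TF mF] := sigma_finiteT (sigma_finite_product m mn).
pose uncons (u : n.+1.-tuple T) := (tnth u ord0, tuple_rem ord0 u).
exists (fun i => uncons @^-1` F i).
  by rewrite -preimage_bigcup -TF preimage_setT.
move=> i; have [mFi Fioo] := mF i; split.
  by rewrite -[X in measurable X]setTI; exact: measurable_uncons_tuple.
rewrite /cons_measure /pushforward -comp_preimage.
by rewrite (_ : uncons \o _ = id) ?preimage_id//; apply/funext/cons_tupleK.
Qed.

HB.instance Definition _ := Measure_isSigmaFinite.Build _ _ _ cons_measure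
  cons_measure_sigma_finite.

End ConsMeasure.

Variable m : {sigma_finite_measure set T -> \bar R}.

Fixpoint tuple_measure n : {sigma_finite_measure set (n.-tuple T) -> \bar R} :=
  if n is n'.+1 then cons_measure m (tuple_measure n') else dirac [tuple].

Section Recursion.
Variables (n : nat) (F : n.+1.-tuple T -> \bar R).
Hypotheses (mF : measurable_fun setT F) (F0 : forall u, 0 <= F u).

Lemma ge0_integral_tuple_measureS :
  \int[tuple_measure n.+1]_u F u =
  \int[m]_z \int[tuple_measure n]_v F (cons_tuple (z, v)).
Proof.
have mc := @measurable_cons_tuple _ T n.
rewrite [LHS](ge0_integral_pushforward mc)// preimage_setT.
rewrite (fubini_tonelli1 (F \o @cons_tuple T n))//; last by move=> w; exact: F0.
exact: measurableT_comp.
Qed.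

Lemma measurable_integral_cons_tuple :
  measurable_fun setT (fun z => \int[tuple_measure n]_v F (cons_tuple (z, v))).
Proof.
apply: (measurable_fun_fubini_tonelli_F (F \o @cons_tuple T n)); last by move=> w; exact: F0.
exact: measurableT_comp mF (@measurable_cons_tuple _ T n).
Qed.

End Recursion.

Lemma measurable_pick n (j : 'I_n.+1) (phi : T * n.-tuple T -> \bar R) :
  measurable_fun setT phi -> measurable_fun setT (fun u => phi (tnth u j, tuple_rem j u)).
Proof.
move=> mphi; apply: (measurableT_comp mphi); apply: measurable_fun_pair.
  exact: measurable_tnth.
exact: measurable_tuple_rem.
Qed.

Lemma ge0_integral_tuple_measure_head n (phi : T * n.-tuple T -> \bar R) :
  measurable_fun setT phi -> (forall w, 0 <= phi w) ->
  \int[tuple_measure n.+1]_u phi (tnth u ord0, tuple_rem ord0 u) =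
  \int[m]_z \int[tuple_measure n]_v phi (z, v).
Proof.
move=> mphi phi0; rewrite (ge0_integral_tuple_measureS (measurable_pick _ mphi)); last first.
  by move=> u; exact: phi0.
by apply: eq_integral => z _; apply: eq_integral => v _; rewrite tnth0 tuple_rem0_cons.
Qed.

Lemma ge0_integral_tuple_measure_pick n (j : 'I_n.+1) (phi : T * n.-tuple T -> \bar R) :
  measurable_fun setT phi -> (forall w, 0 <= phi w) ->
  \int[tuple_measure n.+1]_u phi (tnth u j, tuple_rem j u) =
  \int[m]_z \int[tuple_measure n]_v phi (z, v).
Proof.
elim: n j phi => [|n IH] j phi mphi phi0.
  by rewrite (ord1 j) ge0_integral_tuple_measure_head.
have [i ->|->] := unliftP ord0 j; last exact: ge0_integral_tuple_measure_head.
rewrite (ge0_integral_tuple_measureS (measurable_pick _ mphi)); last by move=> u; exact: phi0.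
have mphi3 : measurable_fun setT (fun w : T * T * n.-tuple T =>
    phi (w.1.2, cons_tuple (w.1.1, w.2))).
  apply: measurableT_comp => //; apply: measurable_fun_pair.
    exact: measurableT_comp measurable_snd measurable_fst.
  apply: measurableT_comp; first exact: measurable_cons_tuple.
  by apply: measurable_fun_pair => //; exact: measurableT_comp measurable_fst measurable_fst.
transitivity (\int[m]_z \int[m]_z' \int[tuple_measure n]_v phi (z', cons_tuple (z, v))).
  apply: eq_integral => z _.
  rewrite -(IH i (fun w => phi (w.1, cons_tuple (z, w.2))))//; last first.
    apply: (measurableT_comp mphi); apply: measurable_fun_pair => //.
    apply: measurableT_comp; first exact: measurable_cons_tuple.
    by apply: measurable_fun_pair => //; exact: measurable_cst.
  by apply: eq_integral => v _; rewrite tnthS tuple_rem_cons.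
rewrite (fubini_tonelli (fun w => \int[tuple_measure n]_v phi (w.2, cons_tuple (w.1, v))))//.
- apply: eq_integral => z _; rewrite ge0_integral_tuple_measureS//.
  by apply: measurableT_comp => //; exact: measurable_pair1.
- exact: (measurable_fun_fubini_tonelli_F _ mphi3).
- by move=> w; exact: integral_ge0.
Qed.

(* Campbell's formula for [n + 1] points. *)
Lemma ge0_integral_tuple_measure_sum_pick n (phi : T * n.-tuple T -> \bar R) :
  measurable_fun setT phi -> (forall w, 0 <= phi w) ->
  \int[tuple_measure n.+1]_u (\sum_(j < n.+1) phi (tnth u j, tuple_rem j u)) =
  n.+1%:R%:E * \int[tuple_measure n]_v \int[m]_z phi (z, v).
Proof.
move=> mphi phi0; have -> : \int[tuple_measure n]_v \int[m]_z phi (z, v) =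
    \int[m]_z \int[tuple_measure n]_v phi (z, v) by rewrite -fubini_tonelli.
rewrite ge0_integral_sum => [||j|j u _]//.
  under eq_bigr do rewrite ge0_integral_tuple_measure_pick//.
  by rewrite big_const_ord iter_addr addr0 mule_natl.
exact: measurable_pick.
Qed.

End TupleMeasure.

Lemma ge0_integral_mrestr d (T : measurableType d) (R : realType)
    (m : {measure set T -> \bar R}) (D : set T) (mD : measurable D) (f : T -> \bar R) :
  measurable_fun setT f -> (forall x, 0 <= f x)%E ->
  (\int[mrestr m mD]_x f x = \int[m]_(x in D) f x)%E.
Proof.
move=> mf f0; rewrite [LHS](ge0_negligible_integral (N := ~` D))//.
- rewrite setTD setCK; apply: eq_measure_integral => A mA AD.
  by rewrite /= /mrestr setIidl.
- exact: measurableC.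
- by rewrite /= /mrestr setICl measure0.
Qed.

Section CylinderMeasure.
Variables (R : realType) (Rad : R).
Local Notation RM := (measurableTypeR R).
Local Notation Z := (RM * RM)%type.
Local Notation mu := (@lebesgue_measure R).

Definition angles : set RM := [set y : R | (0 <= y <= 2 * pi * Rad)%R].

Lemma anglesE : angles = `[0, 2 * pi * Rad]%classic.
Proof. by apply/seteqP; split => y; rewrite /= in_itv. Qed.

Lemma measurable_angles : measurable angles.
Proof. by rewrite anglesE; exact: measurable_itv. Qed.

Lemma lebesgue_measure_angles_lty : (mu angles < +oo)%E.
Proof.
by rewrite anglesE [ltLHS]lebesgue_measure_itv; case: ifP => _; rewrite ltry.
Qed.

Definition cylinder_measure : {sigma_finite_measure set Z -> \bar R} :=
  sigma_finite_product mu (mfrestr measurable_angles lebesgue_measure_angles_lty).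

Lemma fubini_F_angles (f : Z -> \bar R) :
  measurable_fun setT f -> (forall z, 0 <= f z)%E ->
  fubini_F (mfrestr measurable_angles lebesgue_measure_angles_lty) f =
  (fun x => \int[mu]_(y in angles) f (x, y))%E.
Proof.
move=> mf f0; apply/funext => x; rewrite /fubini_F ge0_integral_mrestr//.
by apply: measurableT_comp => //; exact: measurable_pair1.
Qed.

Lemma measurable_integral_angles (f : Z -> \bar R) :
  measurable_fun setT f -> (forall z, 0 <= f z)%E ->
  measurable_fun setT (fun x => \int[mu]_(y in angles) f (x, y))%E.
Proof.
move=> mf f0; rewrite -fubini_F_angles//.
exact: measurable_fun_fubini_tonelli_F.
Qed.

Lemma ge0_integral_cylinder_measure (f : Z -> \bar R) :
  measurable_fun setT f -> (forall z, 0 <= f z)%E ->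
  (\int[cylinder_measure]_z f z = \int[mu]_x \int[mu]_(y in angles) f (x, y))%E.
Proof.
move=> mf f0; rewrite -fubini_F_angles//.
exact: (fubini_tonelli1 (m1 := mu) f mf f0).
Qed.

Lemma cyl_intE n (F : seq (R * R) -> \bar R) :
  measurable_fun setT (fun v : n.-tuple Z => F v) -> (forall v, 0 <= F v)%E ->
  (cyl_int Rad n F = \int[tuple_measure cylinder_measure n]_v F v)%E.
Proof.
elim: n F => [|n IH] F mF F0.
  by rewrite [RHS]integral_dirac// diracT mul1e.
have mFz z : measurable_fun setT (fun v : n.-tuple Z => F (z :: v)).
  by apply: (measurableT_comp mF); exact: measurable_cons.
rewrite (ge0_integral_tuple_measureS _ mF); last by move=> u; exact: F0.
rewrite (ge0_integral_cylinder_measure (measurable_integral_cons_tuple _ mF _)).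
- by apply: eq_integral => x _; apply: eq_integral => y _; exact: (IH _ (mFz (x, y))).
- by move=> u; exact: F0.
- by move=> z; exact: integral_ge0.
Qed.

End CylinderMeasure.

(** * Landau's inequality *)

Lemma deriv_surjective (F : numFieldType) (r : {poly F}) : exists q : {poly F}, q^`() = r.
Proof.
exists (\poly_(i < (size r).+1) (r`_i.-1 / i%:R)); apply/polyP => i.
rewrite coef_deriv coef_poly ltnS; case: ltnP => [_|ri].
  by rewrite -[LHS]mulr_natr divfK ?pnatr_eq0.
by rewrite mul0rn nth_default.
Qed.

Lemma is_derive1_continuous (R : realType) (f : R -> R) (y a : R) :
  is_derive y 1 f a -> {for y, continuous f}.
Proof. by case=> df _; exact/differentiable_continuous/derivable1_diffP. Qed.

Section Landau.
Variable R : realType.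
Local Notation Re := complex.Re.
Local Notation Im := complex.Im.
Local Notation normc := Normc.normc.
Implicit Types (q r : {poly R[i]}) (z : R[i]) (t : R).

Lemma sqr_normc z : normc z ^+ 2 = Re z ^+ 2 + Im z ^+ 2.
Proof. by case: z => a b; rewrite sqr_sqrtr// addr_ge0 ?sqr_ge0. Qed.

Lemma normcX z n : normc (z ^+ n) = normc z ^+ n.
Proof. by elim: n => [|n IH]; rewrite ?Normc.normc1// !exprS Normc.normcM IH. Qed.

Definition cis t : R[i] := (cos t +i* sin t)%C.

Lemma is_derive_horner_cis q t :
  is_derive t 1 (fun t => Re q.[cis t]) (- Im (q^`().[cis t] * cis t)) /\
  is_derive t 1 (fun t => Im q.[cis t]) (Re (q^`().[cis t] * cis t)).
Proof.
elim/poly_ind: q => [|q c [dRe dIm]].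
  rewrite deriv0 horner0 mul0r /= oppr0.
  by split; under eq_fun do rewrite horner0; exact: is_derive_cst.
rewrite derivMXaddC hornerD hornerM hornerX.
have -> : (fun t => Re (q * 'X + c%:P).[cis t]) =
    (fun t => Re q.[cis t] * cos t - Im q.[cis t] * sin t + Re c).
  by apply/funext => u; rewrite hornerMXaddC; case: (q.[_]) c => [a b] [a' b'].
have -> : (fun t => Im (q * 'X + c%:P).[cis t]) =
    (fun t => Re q.[cis t] * sin t + Im q.[cis t] * cos t + Im c).
  by apply/funext => u; rewrite hornerMXaddC; case: (q.[_]) c => [a b] [a' b'].
by split; apply: is_derive_eq; case: (q.[_]) (q^`().[_]) => [a b] [a' b'];
  rewrite /= /GRing.scale/=; ring.
Qed.

Variable Rad : R.
Hypothesis Rad0 : 0 < Rad.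
Local Notation mu := (@lebesgue_measure R).
Local Notation per := (2 * pi * Rad).
Local Notation circ := `[0, per]%classic.

Lemma period_gt0 : 0 < per.
Proof. by rewrite !mulr_gt0 ?pi_gt0. Qed.

Lemma is_derive_horner_cis_div q (y : R) :
  is_derive y 1 (fun y => Re q.[cis (y / Rad)])
    (- Im (q^`().[cis (y / Rad)] * cis (y / Rad)) / Rad) /\
  is_derive y 1 (fun y => Im q.[cis (y / Rad)])
    (Re (q^`().[cis (y / Rad)] * cis (y / Rad)) / Rad).
Proof.
have dy : is_derive y 1 (fun y : R => y / Rad) Rad^-1.
  by apply: is_derive_eq; rewrite scaler0 add0r /GRing.scale/= mulr1.
have [dRe dIm] := is_derive_horner_cis q (y / Rad).
split.
- exact: (@is_derive1_comp _ (fun t => Re q.[cis t]) (fun y => y / Rad) y _ _ dRe dy).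
- exact: (@is_derive1_comp _ (fun t => Im q.[cis t]) (fun y => y / Rad) y _ _ dIm dy).
Qed.

Lemma continuous_horner_cis q :
  continuous (fun y : R => Re q.[cis (y / Rad)]) /\ continuous (fun y : R => Im q.[cis (y / Rad)]).
Proof.
by split => y; have [dRe dIm] := is_derive_horner_cis_div q y;
  [exact: is_derive1_continuous dRe|exact: is_derive1_continuous dIm].
Qed.

Lemma continuous_sqr_normc_horner_cis q : continuous (fun y : R => normc q.[cis (y / Rad)] ^+ 2).
Proof.
have [cRe cIm] := continuous_horner_cis q; rewrite (_ : (fun y : R => _) = fun y =>
    Re q.[cis (y / Rad)] * Re q.[cis (y / Rad)] + Im q.[cis (y / Rad)] * Im q.[cis (y / Rad)]).
  by move=> y; apply: cvgD; apply: cvgM; [exact: cRe|exact: cRe|exact: cIm|exact: cIm].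
by apply/funext => y; rewrite sqr_normc !expr2.
Qed.

(* On the circle, [Re (r 'X)] is the derivative of the imaginary part of an antiderivative
   of [r]. *)
Lemma integral_Re_horner_cis r :
  (\int[mu]_(y in circ) (Re (r * 'X).[cis (y / Rad)])%:E = 0)%E.
Proof.
have [q qr] := deriv_surjective r.
pose G (y : R) := Rad * Im q.[cis (y / Rad)].
have dG (y : R) : is_derive y 1 G (Re (r * 'X).[cis (y / Rad)]).
  have [_ dIm] := is_derive_horner_cis_div q y; apply: is_derive_eq.
  by rewrite qr hornerM hornerX /GRing.scale/= mulrC divfK ?gt_eqF.
have cG y := is_derive1_continuous (dG y).
rewrite (@continuous_FTC2 _ _ G _ _ period_gt0).
- by rewrite /G /cis mulfK ?gt_eqF// mul0r mulr_natl cos2pi sin2pi cos0 sin0 -EFinB subrr.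
- by apply: continuous_subspaceT; have [] := continuous_horner_cis (r * 'X).
- split; [by move=> y _; have [] := dG y|exact/cvg_at_right_filter/cG|].
  exact/cvg_at_left_filter/cG.
- by move=> y _; rewrite derive1E; have [_ ->] := dG y.
Qed.

Lemma landau_inequality q :
  ((per * normc q.[0] ^+ 2)%:E <= \int[mu]_(y in circ) (normc q.[cis (y / Rad)] ^+ 2)%:E)%E.
Proof.
have mcirc : measurable (circ : set (measurableTypeR R)) by exact: measurable_itv.
have icirc (f : R -> R) : continuous f -> mu.-integrable circ (EFin \o f).
  move=> cf; apply: continuous_compact_integrable; first exact: segment_compact.
  exact: continuous_subspaceT.
have mucirc : mu circ = per%:E.
  by rewrite lebesgue_measure_itv/= lte_fin period_gt0 -EFinD subr0.
elim/poly_ind: q => [|r c _].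
  rewrite horner0 Normc.normc0 expr0n mulr0; apply: integral_ge0 => y _.
  by rewrite lee_fin sqr_ge0.
pose g (y : R) := Re ((2 * c^*%C)%:P * r * 'X).[cis (y / Rad)].
have cg : continuous g by have [] := continuous_horner_cis ((2 * c^*%C)%:P * r * 'X).
have icst : mu.-integrable circ (EFin \o cst (normc c ^+ 2)).
  by apply: icirc; exact: cst_continuous.
have -> : (per * normc (r * 'X + c%:P).[0] ^+ 2)%:E =
    (\int[mu]_(y in circ) (normc c ^+ 2 + g y)%:E)%E.
  under eq_integral do rewrite EFinD; rewrite (integralD mcirc icst (icirc _ cg)).
  rewrite integral_Re_horner_cis adde0; apply/esym.
  apply: etrans (integral_cst mu mcirc (normc c ^+ 2)%:E) _.
  by rewrite [X in (_ * X)%E]mucirc -EFinM hornerMXaddC mulr0 add0r mulrC.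
apply: le_integral => // [||y _].
- by apply: icirc => y; apply: cvgD; [exact: cvg_cst|exact: cg].
- by apply: icirc; exact: continuous_sqr_normc_horner_cis.
rewrite lee_fin /g !sqr_normc hornerMXaddC !(hornerM, hornerC, hornerX) -[_ * _ * cis _]mulrA.
move: (r.[_] * _) => [a b]; case: c {g cg icst} => [c1 c2] /=.
by have := sqr_ge0 a; have := sqr_ge0 b; lra.
Qed.

End Landau.

Section Vandermonde.
Variables (R : realType) (Rad : R).
Hypothesis Rad0 : 0 < Rad.
Local Notation mu := (@lebesgue_measure R).
Local Notation normc := Normc.normc.
Implicit Types (x y : R) (z w : R * R) (v : seq (R * R)).

Definition ez z : R[i] := (ez_re Rad z +i* ez_im Rad z)%C.

Lemma sqmod_diffE z w : sqmod_diff Rad z w = normc (ez w - ez z) ^+ 2.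
Proof. by rewrite sqr_normc. Qed.

Lemma sqmod_diff_ge0 z w : 0 <= sqmod_diff Rad z w.
Proof. by rewrite sqmod_diffE sqr_ge0. Qed.

Lemma sqmod_diffC z w : sqmod_diff Rad z w = sqmod_diff Rad w z.
Proof. by rewrite !sqmod_diffE -opprB normcN. Qed.

Lemma normc_ez z : normc (ez z) = expR (z.1 / Rad).
Proof.
rewrite /= /ez_re /ez_im !exprMn -mulrDr cos2Dsin2 mulr1 sqrtr_sqr.
by rewrite ger0_norm// expR_ge0.
Qed.

Lemma sqmod_diff_le z w :
  sqmod_diff Rad z w <= (expR (z.1 / Rad) + expR (w.1 / Rad)) ^+ 2.
Proof.
rewrite sqmod_diffE lerXn2r ?nnegrE ?addr_ge0 ?expR_ge0//.
  by case: (_ - _) => a b; exact: sqrtr_ge0.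
by rewrite -!normc_ez addrC -(normcN (ez z)) le_normcD.
Qed.

Definition maxexp x x' : R := expR (Num.max x x' / Rad).

Lemma expR_min x x' :
  expR (Num.min x x' / Rad) = maxexp x x' * expR (- (`|x - x'| / Rad)).
Proof.
rewrite /maxexp -expRD; congr expR; have [xx'|/ltW x'x] := leP x x'.
  by rewrite ler0_norm ?subr_le0// mulNr opprK mulrBl addrC subrK.
by rewrite ger0_norm ?subr_ge0// mulrBl opprB addrC subrK.
Qed.

Definition linear_factor x w : {poly R[i]} :=
  1 - ((expR (- (`|x - w.1| / Rad)))%:C%C * (cis (w.2 / Rad))^*%C) *: 'X.

Lemma linear_factor0 x w : (linear_factor x w).[0] = 1.
Proof. by rewrite !hornerE subr0. Qed.

(* The larger of [|e^z|], [|e^w|] factors out, leaving a polynomial in [e^{iy/Rad}]. *)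
Lemma sqmod_diff_linear_factor x y w : sqmod_diff Rad (x, y) w =
  maxexp x w.1 ^+ 2 * normc (linear_factor x w).[cis (y / Rad)] ^+ 2.
Proof.
rewrite sqr_normc /linear_factor !hornerE /sqmod_diff /ez_re /ez_im /= /maxexp.
have := cos2Dsin2 (w.2 / Rad); have := cos2Dsin2 (y / Rad).
set C := cos (w.2 / Rad); set S := sin (w.2 / Rad).
set C' := cos (y / Rad); set S' := sin (y / Rad) => CS1' CS1.
set E := expR (- _); transitivity (expR (Num.max x w.1 / Rad) ^+ 2 *
    (1 + E ^+ 2 - 2 * E * (C * C' + S * S'))); last first.
  congr (_ * _); have : E ^+ 2 * ((C' ^+ 2 + S' ^+ 2) * (C ^+ 2 + S ^+ 2)) = E ^+ 2.
    by rewrite CS1 CS1' !mulr1.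
  lra.
have cross M M' : (M * C - M' * C') ^+ 2 + (M * S - M' * S') ^+ 2 =
    M ^+ 2 + M' ^+ 2 - 2 * M * M' * (C * C' + S * S').
  transitivity (M ^+ 2 * (C ^+ 2 + S ^+ 2) + M' ^+ 2 * (C' ^+ 2 + S' ^+ 2) -
    2 * M * M' * (C * C' + S * S')); [ring|by rewrite CS1 CS1' !mulr1].
rewrite cross; have := expR_min x w.1; rewrite -/E /maxexp.
by have [_|_] := leP x w.1 => ->; ring.
Qed.

Lemma prod_sqmod_diff_linear_factor p x y v :
  \prod_(w <- v) sqmod_diff Rad (x, y) w ^+ p = \prod_(w <- v) maxexp x w.1 ^+ (2 * p) *
    normc (\prod_(w <- v) linear_factor x w ^+ p).[cis (y / Rad)] ^+ 2.
Proof.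
elim: v => [|w v IH]; first by rewrite !big_nil hornerC Normc.normc1 expr1n mulr1.
rewrite !big_cons IH sqmod_diff_linear_factor hornerM horner_exp Normc.normcM normcX.
by rewrite exprMn -!exprM exprMn -exprM (mulnC p 2) mulrACA.
Qed.

Lemma integral_prod_sqmod_diff_ge p x v :
  ((2 * pi * Rad * \prod_(w <- v) maxexp x w.1 ^+ (2 * p))%:E <=
   \int[mu]_(y in angles Rad) (\prod_(w <- v) sqmod_diff Rad (x, y) w ^+ p)%:E)%E.
Proof.
pose q := \prod_(w <- v) linear_factor x w ^+ p.
have q0 : q.[0] = 1.
  by rewrite horner_prod big1// => w _; rewrite horner_exp linear_factor0 expr1n.
have P0 : 0 <= \prod_(w <- v) maxexp x w.1 ^+ (2 * p).
  by apply: prodr_ge0 => w _; rewrite exprn_ge0// expR_ge0.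
under eq_integral do rewrite prod_sqmod_diff_linear_factor EFinM.
rewrite ge0_integralZl//.
- rewrite mulrC EFinM lee_wpmul2l// anglesE; have := landau_inequality Rad0 q.
  by rewrite q0 Normc.normc1 expr1n mulr1.
- exact: measurable_angles.
- apply/measurable_EFinP/measurable_funTS; apply: continuous_measurable_fun.
  exact: continuous_sqr_normc_horner_cis.
- by move=> y _; rewrite lee_fin sqr_ge0.
Qed.

End Vandermonde.

(** * Occupation numbers *)

Section Occupation.
Local Open Scope nat_scope.
Implicit Types (M k s t c : nat) (cs : seq nat).

Definition below k cs := count (fun c => c < k) cs.

Definition excess k cs := `|below k cs - k|.

(* [cs] lists the cells of the particles, so that [excess i cs] is [|K|] at site [i]. *)
Definition excess_peak M k s t cs :=
  (excess k cs == t) && all (fun i => excess i cs <= s + `|i - k|) (iota 1 M).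

Lemma excess_peakP M k s t cs : reflect
  (excess k cs = t /\ forall i, 0 < i <= M -> excess i cs <= s + `|i - k|)
  (excess_peak M k s t cs).
Proof.
apply: (iffP andP) => -[/eqP-> H]; split => //.
  by move=> i iM; apply: (allP H); rewrite mem_iota; lia.
by apply/allP => i; rewrite mem_iota => iM; apply: H; lia.
Qed.

Lemma perm_below k cs cs' : perm_eq cs cs' -> below k cs = below k cs'.
Proof. by move/permP => /(_ (fun c => c < k)). Qed.

Lemma perm_excess_peak M k s t cs cs' : perm_eq cs cs' ->
  excess_peak M k s t cs = excess_peak M k s t cs'.
Proof.
move=> ecs; rewrite /excess_peak /excess (perm_below _ ecs); congr (_ && _).
by apply: eq_all => i; rewrite (perm_below _ ecs).
Qed.

Lemma below0 cs : below 0 cs = 0. Proof. by elim: cs. Qed.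

Lemma belowS k cs : below k.+1 cs = below k cs + count_mem k cs.
Proof. by elim: cs => //= c cs; rewrite /below /=; lia. Qed.

Lemma below_le_size k cs : below k cs <= size cs. Proof. exact: count_size. Qed.

Lemma below_eq_size k cs : all (fun c => c < k) cs -> below k cs = size cs.
Proof. by rewrite all_count => /eqP. Qed.

Lemma count_mem_excess_peak M k s t c cs : size cs = M.+1 -> all (fun c => c < M.+1) cs ->
  0 < k <= M -> excess_peak M k s t cs -> count_mem c cs <= 2 * (s + 1 + `|c - k|).
Proof.
move=> sz csM kM /excess_peakP[_ H].
have [cM|cM] := leqP c M; last first.
  rewrite (count_memPn _)//; apply/negP => /(allP csM) /=; lia.
have := belowS c cs; have b0 := below0 cs; have bM := below_eq_size csM.
have Hc := H c; have Hc1 := H c.+1; rewrite /excess sz in bM Hc Hc1.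
have [c0|c0] := posnP c; first by subst c; lia.
have [cM'|cM'] := ltnP c M; first by lia.
have eM : c = M by lia.
by subst c; lia.
Qed.

Definition overfull_side k c cs :=
  (c < k) && (k < below k (c :: cs)) || (k <= c) && (below k (c :: cs) < k).

Lemma below_overfull_side M k s t c cs : excess_peak M k s t (c :: cs) ->
  overfull_side k c cs ->
  (c < k) && (below k cs == k + t - 1) || (k <= c) && (below k cs + t == k).
Proof. by move=> /excess_peakP[<- _]; rewrite /overfull_side /excess /below /=; lia. Qed.

Lemma excess_peak_move M k s t c cs : excess_peak M k s t.+1 (c :: cs) ->
  overfull_side k c cs -> excess_peak M k s.+1 t (below k cs :: cs).
Proof.
have bE k' c' : below k' (c' :: cs) = (c' < k') + below k' cs by [].
move=> /excess_peakP[Ht H] Hc; apply/excess_peakP.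
move: Ht Hc; rewrite /overfull_side /excess !bE => Ht Hc; split; first by lia.
by move=> i /H; rewrite /excess !bE; lia.
Qed.

(* A maximiser of the excess minus the distance to [k]. *)
Lemma excess_peak_exists M k n cs : size cs = M.+1 -> 0 < k <= M -> n <= excess k cs ->
  exists2 j, 0 < j <= M & exists2 i, i < M.+2 &
    let m := n + `|j - k| + i in excess_peak M j m m cs.
Proof.
move=> sz kM kn; have lt_pred (i : nat) : 0 < i <= M -> i.-1 < M by lia.
pose f (i : 'I_M) := excess i.+1 cs + (M - `|i.+1 - k|).
have [j _ fj] := @arg_maxnP _ (Ordinal (lt_pred k kM)) xpredT f isT.
have jM : 0 < j.+1 <= M by rewrite ltn_ord.
have jmax i : 0 < i <= M -> excess i cs + `|j.+1 - k| <= excess j.+1 cs + `|i - k|.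
  by move=> iM; have := fj (Ordinal (lt_pred i iM)) isT; rewrite /f /= prednK; lia.
have ej : excess j.+1 cs <= M.+1.
  by have := below_le_size j.+1 cs; rewrite /excess; lia.
have nj := jmax k kM.
exists j.+1 => //; exists (excess j.+1 cs - n - `|j.+1 - k|); first by lia.
have -> /= : n + `|j.+1 - k| + (excess j.+1 cs - n - `|j.+1 - k|) = excess j.+1 cs by lia.
apply/excess_peakP; split => // i iM; have := jmax i iM; lia.
Qed.

End Occupation.

Lemma sum_count_mem (R : pzSemiRingType) (F : nat -> R) n cs : all (fun c => c < n)%N cs ->
  \sum_(c <- cs) F c = \sum_(i < n) (count_mem (i : nat) cs)%:R * F i.
Proof.
elim: cs => [_|c cs IH /= /andP[cn /IH csn]].
  by rewrite big_nil big1// => i _; rewrite mul0r.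
rewrite big_cons csn; under [RHS]eq_bigr do rewrite natrD mulrDl.
rewrite big_split /=; congr (_ + _); rewrite (bigD1 (Ordinal cn))//= eqxx mul1r.
by rewrite big1 ?addr0// => i; rewrite -val_eqE eq_sym => /= /negbTE->; rewrite mul0r.
Qed.

Section GeometricSums.
Variable R : realFieldType.

Lemma sum_distn_le (F : nat -> R) (B : R) (n d : nat) : (forall i, 0 <= F i) ->
  (forall m, \sum_(i < m) F i <= B) -> \sum_(i < n) F `|i - d|%N <= 2 * B.
Proof.
move=> F0 FB; apply: (@le_trans _ _ (\sum_(i < d + n) F `|i - d|%N)).
  by rewrite addnC big_split_ord /= lerDl sumr_ge0.
rewrite big_split_ord /= mulr_natl mulr2n; apply: lerD.
  rewrite (reindex_inj rev_ord_inj) /=; apply: le_trans (FB d.+1).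
  rewrite big_ord_recl ler_wpDl// ler_sum// => i _.
  by rewrite (_ : `|_ - d|%N = lift ord0 i)//= /bump; have := ltn_ord i; lia.
have -> : \sum_(i < n) F `|d + i - d|%N = \sum_(i < n) F i.
  by apply: eq_bigr => i _; congr F; lia.
exact: FB.
Qed.

Variable th : R.
Hypothesis th01 : 0 < th < 1.

Lemma geometric_sum_le n : \sum_(i < n) th ^+ i <= (1 - th)^-1.
Proof.
have [th0 th1] := andP th01; have d0 : 0 < 1 - th by rewrite subr_gt0.
rewrite -(ler_pM2l d0) divff ?gt_eqF// -opprB mulNr -subrX1.
by rewrite opprB gerBl exprn_ge0// ltW.
Qed.

Lemma arith_geometric_sum_le n : \sum_(i < n) (1 + i%:R) * th ^+ i <= (1 - th) ^- 2.
Proof.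
have [th0 th1] := andP th01; have d0 : 0 < 1 - th by rewrite subr_gt0.
suff -> : \sum_(i < n) (1 + i%:R) * th ^+ i =
    (1 - th ^+ n * (1 + n%:R * (1 - th))) / (1 - th) ^+ 2.
  rewrite ler_pdivrMr ?exprn_gt0// mulVf ?expf_neq0 ?gt_eqF// gerBl.
  by rewrite mulr_ge0 ?exprn_ge0 ?addr_ge0 ?mulr_ge0// ltW.
elim: n => [|n IH]; first by rewrite big_ord0 expr0 mul0r addr0 mul1r subrr mul0r.
rewrite big_ord_recr /= IH [th ^+ n.+1]exprS -natr1; field.
by rewrite gt_eqF.
Qed.

End GeometricSums.

Lemma sqr_le_cube (R : realFieldType) (b c x : R) : 0 < b -> 0 < c -> 0 <= x ->
  b * x ^+ 2 <= b * (b / c) ^+ 2 + c * x ^+ 3.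
Proof.
move=> b0 c0 x0; have [xb|/ltW] := leP x (b / c).
  apply: (@le_trans _ _ (b * (b / c) ^+ 2)).
    by rewrite ler_wpM2l ?(ltW b0)// lerXn2r ?nnegrE// divr_ge0 ?ltW.
  by rewrite lerDl mulr_ge0 ?exprn_ge0// ltW.
rewrite ler_pdivrMr// => bcx; apply: (@le_trans _ _ (c * x ^+ 3)).
  by rewrite (_ : c * x ^+ 3 = x * c * x ^+ 2) ?ler_wpM2r ?sqr_ge0//; ring.
by rewrite lerDr mulr_ge0 ?sqr_ge0// ltW.
Qed.

Lemma leq_cubeD (i j : nat) : (i ^ 3 + j <= (i + j) ^ 3)%N.
Proof.
elim: j => [|j IH]; first by rewrite !addn0.
by rewrite !addnS (leq_ltn_trans IH)// ltn_exp2r.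
Qed.

Lemma sum_expR_cube_le (R : realType) (c : R) (n k M L : nat) : 0 < c -> (0 < k)%N ->
  \sum_(j < M) \sum_(i < L) expR (- (c * (n + `|j.+1 - k| + i)%:R ^+ 3)) <=
  2 * (1 - expR (- c)) ^- 2 * expR (- (c * n%:R ^+ 3)).
Proof.
move=> c0 k0; set th := expR (- c).
have th01 : 0 < th < 1 by rewrite expR_gt0 expR_lt1 oppr_lt0.
have [th0 th1] := andP th01; have G0 : 0 <= (1 - th)^-1 by rewrite invr_ge0 subr_ge0 ltW.
have geom := geometric_sum_le th01.
apply: (@le_trans _ _ (expR (- (c * n%:R ^+ 3)) *
    ((\sum_(j < M) th ^+ `|j - k.-1|) * (\sum_(i < L) th ^+ i)))).
  rewrite mulr_suml mulr_sumr; apply: ler_sum => j _; rewrite !mulr_sumr; apply: ler_sum => i _.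
  rewrite -!expRM_natl -!expRD ler_expR (_ : `|j - k.-1|%N = `|j.+1 - k|%N); last by lia.
  set d := `|j.+1 - k|%N; have : n%:R ^+ 3 + d%:R + i%:R <= (n + d + i)%:R ^+ 3 :> R.
    by rewrite -!natrX -!natrD ler_nat (leq_trans _ (leq_cubeD _ _))// leq_add2r leq_cubeD.
  by move/(ler_wpM2l (ltW c0)); lra.
rewrite mulrC ler_wpM2r ?expR_ge0// -exprVn expr2 mulrA ler_pM ?sumr_ge0//.
- by move=> j _; rewrite exprn_ge0// ltW.
- by move=> i _; rewrite exprn_ge0// ltW.
- by apply: sum_distn_le => // i; rewrite exprn_ge0// ltW.
Qed.

(** * Cells and screening *)

Section Cells.
Variables (R : realType) (a : R).
Hypothesis a0 : 0 < a.
Implicit Types (x : R) (M k j : nat) (xs : seq R).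

Definition site k : R := (k%:R - 2^-1) * a.

Lemma ler_site j k : (site j <= site k) = (j <= k)%N.
Proof. by rewrite ler_pM2r// lerD2r ler_nat. Qed.

(* The sites [1, ..., M] cut the line into the cells [0, ..., M]. *)
Definition cell M x := count (fun j => site j < x) (iota 1 M).

Lemma cell_le M x : (cell M x <= M)%N.
Proof. by rewrite -[leqRHS](size_iota 1) count_size. Qed.

Lemma lt_cell M x x' : (cell M x < cell M x')%N -> x < x'.
Proof.
apply: contraTT; rewrite -leNgt -leqNgt => x'x.
by apply: sub_count => j /= /lt_le_trans; exact.
Qed.

Lemma cell_ltE M k x : (0 < k <= M)%N -> (cell M x < k)%N = (x <= site k).
Proof.
move=> kM; have count_ltn i : (i <= M)%N -> count (fun j => j < i.+1)%N (iota 1 M) = i.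
  by move=> iM; rewrite -size_filter (filter_iota_ltn 1 iM) size_iota.
rewrite /cell; case: leP => xk; apply/idP.
  rewrite -[X in (_ < X)%N]prednK -1?(count_ltn k.-1) ?ltnS ?prednK; try lia.
  by apply: sub_count => j /= /lt_le_trans/(_ xk); rewrite ltNge ler_site -ltnNge.
apply/negP; rewrite -leqNgt -[leqLHS]count_ltn; last by lia.
by apply: sub_count => j /=; rewrite ltnS => jk; rewrite (le_lt_trans _ xk)// ler_site.
Qed.

Lemma cell_eq M L x : (L <= M)%N -> site L < x <= site L.+1 -> cell M x = L.
Proof.
move=> LM /andP[Lx xL]; apply/eqP; rewrite eqn_leq; apply/andP; split.
  by case: (ltnP L M) => [LltM|/(leq_trans (cell_le _ _))//]; rewrite -ltnS cell_ltE.
case: L LM Lx {xL} => // L LM Lx; rewrite leqNgt cell_ltE ?LM//.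
by rewrite -ltNge.
Qed.

Lemma cell_site M k : (0 < k <= M)%N -> cell M (site k) = k.-1.
Proof. by move=> kM; apply: cell_eq; rewrite ?ler_site ?ltNge ?ler_site; lia. Qed.

Lemma cell_window M L x : (L <= M)%N -> `|x - L%:R * a| <= a / 4 -> cell M x = L.
Proof.
move=> LM; rewrite ler_norml => /andP[xl xr]; apply: cell_eq => //.
rewrite /site -[L.+1%:R]natr1 !mulrDl !mulNr; have a_gt0 := a0.
by apply/andP; split; lra.
Qed.

Lemma cell_dist M x x' : `|cell M x - cell M x'|%N%:R * a <= `|x - x'| + a.
Proof.
wlog cc : x x' / (cell M x <= cell M x')%N.
  by move=> H; have [/H//|/ltnW/H] := leqP (cell M x) (cell M x'); rewrite distrC distnC.
have -> : `|cell M x - cell M x'|%N = (cell M x' - cell M x)%N by lia.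
have := ler_norm (x' - x); rewrite distrC; move: cc.
rewrite leq_eqVlt => /predU1P[->|cc]; first by rewrite subnn mul0r addr_ge0// ltW.
have xc : x <= site (cell M x).+1 by rewrite -(@cell_ltE M) //; have := cell_le M x'; lia.
have cx' : site (cell M x') < x' by rewrite ltNge -(@cell_ltE M) ?ltnn ?cell_le//; lia.
move: xc cx'; rewrite natrB ?(ltnW cc)// /site -[(cell M x).+1%:R]natr1 !mulrDl !mulNr.
by lra.
Qed.

Lemma cell_dist_site M k x : (0 < k <= M)%N ->
  `|cell M x - k|%N%:R * a <= `|x - site k| + 2 * a.
Proof.
move=> kM; have := cell_dist M x (site k); rewrite cell_site// => cxk.
have : (`|cell M x - k|%N%:R * a <= (`|cell M x - k.-1|%N + 1)%:R * a).
  by rewrite ler_pM2r// ler_nat; lia.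
rewrite natrD; lra.
Qed.

(* [L a] is on the other side of the site [k] than [x], at distance at least [(t - 1/2) a]. *)
Lemma displacement_ge M k t L x : (0 < k <= M)%N -> (0 < t)%N ->
  ((cell M x < k) && (L == k + t - 1) || (k <= cell M x) && (L + t == k))%N ->
  `|x - site k| <= `|x - L%:R * a| /\ t%:R * a / 2 <= `|x - L%:R * a|.
Proof.
move=> kM t0; have a_gt0 := a0; have ta : a <= t%:R * a by rewrite ler_peMl ?ler1n// ltW.
rewrite [(k <= _)%N]leqNgt (cell_ltE _ kM) -ltNge /site mulrDl mulNr.
case/orP=> /andP[xk /eqP Lk].
  have -> : L%:R * a = k%:R * a + t%:R * a - a.
    by rewrite Lk natrB ?natrD; [ring|lia].
  by rewrite !ler0_norm; [split|..]; lra.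
have {Lk} Lk : L%:R * a + t%:R * a = k%:R * a by rewrite -mulrDl -natrD Lk.
by rewrite !ger0_norm; [split|..]; lra.
Qed.

Variable b : R.
Hypothesis b0 : 0 < b.

Definition decay : R := expR (- (a / b)).

Lemma decay_itv : 0 < decay < 1.
Proof. by rewrite expR_gt0 expR_lt1 oppr_lt0 divr_gt0. Qed.

Lemma expR_dist_le_decay M x x' :
  expR (- (`|x - x'| / b)) <= decay^-1 * decay ^+ `|cell M x' - cell M x|.
Proof.
rewrite -expRN -expRM_natl -expRD ler_expR mulrN -mulrN opprK -(ler_pM2r b0).
have := cell_dist M x x'; rewrite distnC => cxx'.
rewrite mulNr divfK ?gt_eqF// mulrDl divfK ?gt_eqF// -mulrA mulNr divfK ?gt_eqF// mulrN.
by lra.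
Qed.

Definition screening : R := 4 * (decay^-1 * (1 - decay) ^- 2).

Lemma screening_gt0 : 0 < screening.
Proof.
have [d0 d1] := andP decay_itv.
by rewrite !mulr_gt0 ?invr_gt0 ?exprn_gt0 ?subr_gt0.
Qed.

Lemma sum_expR_dist_le M s k x xs :
  (forall c, (count_mem c [seq cell M y | y <- xs] <= 2 * (s + 1 + `|c - k|))%N) ->
  \sum_(y <- xs) expR (- (`|x - y| / b)) <= screening * (s + 1 + `|cell M x - k|)%:R.
Proof.
move=> occ; have [d0 d1] := andP decay_itv; set c0 := cell M x.
pose K : R := 2 * (s + 1 + `|c0 - k|)%:R * decay^-1.
pose F i : R := (1 + i%:R) * decay ^+ i.
have F0 i : 0 <= F i by rewrite mulr_ge0 ?exprn_ge0 ?addr_ge0// ltW.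
apply: (@le_trans _ _ (\sum_(c <- [seq cell M y | y <- xs]) decay^-1 * decay ^+ `|c - c0|)).
  by rewrite big_map ler_sum// => y _; exact: expR_dist_le_decay.
rewrite (@sum_count_mem _ (fun c => decay^-1 * decay ^+ `|c - c0|) M.+1); last first.
  by apply/allP => c /mapP[y _ ->]; rewrite ltnS cell_le.
apply: (@le_trans _ _ (\sum_(c < M.+1) K * F `|c - c0|%N)).
  apply: ler_sum => c _; rewrite /K /F !mulrA ler_wpM2r ?exprn_ge0 ?(ltW d0)//.
  rewrite [leRHS]mulrAC ler_wpM2r ?invr_ge0 ?(ltW d0)// -mulrA nat1r -!natrM ler_nat.
  by apply: leq_trans (occ c) _; nia.
rewrite -mulr_sumr; apply: le_trans (ler_wpM2l _ (sum_distn_le _ _ F0 _)) _.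
- by rewrite !mulr_ge0 ?invr_ge0 ?(ltW d0).
- exact: (arith_geometric_sum_le decay_itv).
by rewrite /K /screening le_eqVlt; apply/predU1P; left; ring.
Qed.

End Cells.

(** * The one-particle density *)

Definition spacing (R : realType) (Rad ell : R) (p : nat) : R := p%:R * ell ^+ 2 / Rad.

Section OneBody.
Variables (R : realType) (Rad ell : R) (p : nat).
Implicit Types (x y : R) (z w : R * R) (v : seq (R * R)).
Local Notation Lsq := (laughlin_sq Rad ell p).

Definition one_body z v : R :=
  \prod_(w <- v) sqmod_diff Rad z w ^+ p * expR (- (z.1 ^+ 2 / ell ^+ 2)).

Lemma one_body_ge0 z v : 0 <= one_body z v.
Proof.
by rewrite mulr_ge0 ?expR_ge0// prodr_ge0// => w _; rewrite exprn_ge0// sqmod_diff_ge0.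
Qed.

Lemma laughlin_sq_cons z v : Lsq (z :: v) = one_body z v * Lsq v.
Proof.
rewrite /laughlin_sq /one_body /= big_ord_recl /= [in LHS]big_ord_recl /=.
rewrite [X in X * _ * _](_ : _ = \prod_(w <- v) sqmod_diff Rad z w ^+ p); last first.
  by rewrite big_mkcond big_ord_recl /= mul1r (big_nth (0, 0)) big_mkord.
rewrite [X in _ * X * _](_ : _ = \prod_(j < size v) \prod_(k < size v | (j < k)%N)
    sqmod_diff Rad (nth (0, 0) v j) (nth (0, 0) v k) ^+ p); last first.
  apply: eq_bigr => i _; rewrite big_mkcond big_ord_recl /= mul1r [RHS]big_mkcond.
  by apply: eq_bigr => j _; rewrite ltnS.
by rewrite opprD mulrDl expRD !mulNr; ring.
Qed.

Lemma laughlin_sq_ge0 v : 0 <= Lsq v.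
Proof.
elim: v => [|z v IH]; last by rewrite laughlin_sq_cons mulr_ge0// one_body_ge0.
by rewrite /laughlin_sq mulr_ge0 ?expR_ge0// big_ord0.
Qed.

Lemma perm_one_body z v v' : perm_eq v v' -> one_body z v = one_body z v'.
Proof. by move=> vv'; rewrite /one_body (perm_big _ vv'). Qed.

Lemma laughlin_sq_swap z w v : Lsq [:: z, w & v] = Lsq [:: w, z & v].
Proof. by rewrite !laughlin_sq_cons /one_body !big_cons sqmod_diffC; ring. Qed.

Lemma perm_laughlin_sq v v' : perm_eq v v' -> Lsq v = Lsq v'.
Proof.
have to_front z s1 s2 : Lsq (s1 ++ z :: s2) = Lsq (z :: s1 ++ s2).
  elim: s1 => // w s1 IH; rewrite laughlin_sq_swap !(laughlin_sq_cons w) IH.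
  by congr (_ * _); apply: perm_one_body; rewrite perm_catC /= perm_cons perm_catC.
elim: v v' => [|z v IH] v' zvv'; first by rewrite (perm_nilP (etrans (perm_sym _ _) zvv')).
have zv' : z \in v' by rewrite -(perm_mem zvv') mem_head.
case/splitPr: zv' zvv' => s1 s2; rewrite perm_sym perm_catC /= perm_cons perm_catC perm_sym => vs.
by rewrite to_front !laughlin_sq_cons (IH _ vs) (perm_one_body _ vs).
Qed.

Lemma laughlin_sq_tuple_rem n (j : 'I_n.+1) (u : n.+1.-tuple (R * R)) :
  Lsq u = one_body (tnth u j) (tuple_rem j u) * Lsq (tuple_rem j u).
Proof. by rewrite (perm_laughlin_sq (perm_tuple_rem j u)) laughlin_sq_cons. Qed.

Definition one_body_max x v : R :=
  \prod_(w <- v) maxexp Rad x w.1 ^+ (2 * p) * expR (- (x ^+ 2 / ell ^+ 2)).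

Lemma one_body_max_ge0 x v : 0 <= one_body_max x v.
Proof.
by rewrite mulr_ge0 ?expR_ge0// prodr_ge0// => w _; rewrite exprn_ge0// expR_ge0.
Qed.

Definition separates (left : pred (R * R)) x v :=
  all (fun w => if left w then w.1 <= x else x <= w.1) v.

Hypothesis Rad0 : 0 < Rad.

Lemma expRD_le_maxexp (left : bool) x x' y : (if left then y <= x else x <= y) ->
  expR (x / Rad) + expR (y / Rad) <=
  expR (left%:R * ((x - x') / Rad) + expR (- (`|x - y| / Rad))) * maxexp Rad x' y.
Proof.
move=> xy; pose E := expR (- (`|x - y| / Rad)).
have -> : expR (x / Rad) + expR (y / Rad) = maxexp Rad x y * (1 + E).
  rewrite mulrDr mulr1 -expR_min /maxexp; have [_|_] := leP x y => //; exact: addrC.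
have mono s t : s <= t -> expR (s / Rad) <= expR (t / Rad) by rewrite ler_expR ler_pM2r ?invr_gt0.
apply: (@le_trans _ _ (maxexp Rad x y * expR E)).
  by rewrite ler_wpM2l ?expR_ge0 ?expR_ge1Dx.
rewrite expRD -[leRHS]mulrA [leRHS]mulrCA mulrC ler_wpM2l ?expR_ge0//.
rewrite -expRD mulrA -mulrDl mono//; case: left xy => xy.
  by rewrite (max_l xy) mul1r -addrA lerDl addrC subr_ge0 le_max lexx.
by rewrite (max_r xy) mul0r add0r le_max lexx orbT.
Qed.

Lemma prod_sqmod_diff_le (left : pred (R * R)) x y x' v : separates left x v ->
  \prod_(w <- v) sqmod_diff Rad (x, y) w ^+ p <=
  expR ((2 * p)%:R * ((count left v)%:R * ((x - x') / Rad) +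
                      \sum_(w <- v) expR (- (`|x - w.1| / Rad)))) *
  \prod_(w <- v) maxexp Rad x' w.1 ^+ (2 * p).
Proof.
move=> /allP sep; have -> : (count left v)%:R * ((x - x') / Rad) =
    \sum_(w <- v) (left w)%:R * ((x - x') / Rad).
  by rewrite -mulr_suml -natr_sum -sum1_count big_mkcond.
rewrite -big_split mulr_sumr expR_sum -big_split /= big_seq [leRHS]big_seq.
apply: ler_prod => w wv; rewrite exprn_ge0 ?sqmod_diff_ge0//= expRM_natl -exprMn exprM.
rewrite lerXn2r ?nnegrE ?sqmod_diff_ge0 ?sqr_ge0//.
apply: le_trans (sqmod_diff_le _ _ _) _.
rewrite lerXn2r ?nnegrE ?addr_ge0 ?mulr_ge0 ?expR_ge0//.
exact: expRD_le_maxexp (sep w wv).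
Qed.

Hypothesis ell0 : 0 < ell.

(* Completing the square: with [L] particles to the left of it, a particle at [x]
   sees a harmonic well centred at [L a]. *)
Lemma one_body_le (left : pred (R * R)) x y x' v :
  let c := (count left v)%:R * spacing Rad ell p in
  separates left x v ->
  one_body (x, y) v <=
  expR (((x' - c) ^+ 2 - (x - c) ^+ 2) / ell ^+ 2 +
        (2 * p)%:R * \sum_(w <- v) expR (- (`|x - w.1| / Rad))) * one_body_max x' v.
Proof.
move=> c sep; rewrite /one_body /one_body_max /=.
apply: le_trans (ler_wpM2r (expR_ge0 _) (prod_sqmod_diff_le y x' sep)) _.
set P := \prod_(i <- v) _; set S := \sum_(w <- v) _.
rewrite [leLHS]mulrAC -expRD (mulrC P) [leRHS]mulrA -expRD le_eqVlt; apply/predU1P; left.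
by congr (expR _ * _); rewrite /c /spacing natrM; field; rewrite !gt_eqF.
Qed.

End OneBody.

Section Pivot.
Variables (R : realType) (Rad ell : R) (p : nat).
Hypotheses (Rad0 : 0 < Rad) (ell0 : 0 < ell) (p0 : (0 < p)%N).
Implicit Types (x y u : R) (z w : R * R) (M k s t : nat) (v : seq (R * R)).
Local Notation a := (spacing Rad ell p).
Local Notation cell := (cell a).
Local Notation one_body := (one_body Rad ell p).

Lemma spacing_gt0 : 0 < a.
Proof. by rewrite divr_gt0// mulr_gt0 ?exprn_gt0// ltr0n. Qed.

Lemma xbarE k : xbar Rad ell p k = site a k.
Proof. by rewrite /xbar /site /spacing !mulrA. Qed.

Definition cells M v := [seq cell M w.1 | w <- v].

Lemma cells_cons M z v : cells M (z :: v) = cell M z.1 :: cells M v.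
Proof. by []. Qed.

Lemma cells_le M v : all (fun c => c < M.+1)%N (cells M v).
Proof. by apply/allP => c /mapP[w _ ->]; rewrite ltnS cell_le. Qed.

Lemma below_cells M k v : below k (cells M v) = count (fun w => (cell M w.1 < k)%N) v.
Proof. by rewrite /below count_map. Qed.

Lemma Kexcess_cells M k v : (0 < k <= M)%N ->
  `|Kexcess (xbar Rad ell p k) k v| = (excess k (cells M v))%:Z.
Proof.
move=> kM; rewrite /excess below_cells /Kexcess xbarE.
rewrite (eq_count (a2 := fun w => (cell M w.1 < k)%N)); first by lia.
by move=> w /=; rewrite cell_ltE// spacing_gt0.
Qed.

Definition pivot M k z v :=
  overfull_side k (cell M z.1) (cells M v) && separates (fun w => cell M w.1 < k)%N z.1 v.

Definition crowding : R := (2 * p)%:R * screening a Rad.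

Definition well_rate : R := a ^+ 2 / (16 * ell ^+ 2).

Definition exchange_exponent s t : R :=
  crowding * (s + 3)%:R + (crowding * ell / a) ^+ 2 + well_rate - well_rate * t%:R ^+ 2.

Lemma crowding_gt0 : 0 < crowding.
Proof. by rewrite mulr_gt0 ?ltr0n ?muln_gt0 ?screening_gt0 ?spacing_gt0. Qed.

Lemma well_rate_gt0 : 0 < well_rate.
Proof. by rewrite divr_gt0 ?exprn_gt0 ?spacing_gt0 ?mulr_gt0 ?exprn_gt0. Qed.

(* AM-GM absorbs the term linear in [u] in half of the quadratic gain; the other half is kept,
   shared between the rate and the Gaussian. *)
Lemma well_exponent_le W u u' t : `|u'| <= a / 4 -> t%:R * a / 2 <= `|u| ->
  (u' ^+ 2 - u ^+ 2) / ell ^+ 2 + W * (`|u| / a) <=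
  (W * ell / a) ^+ 2 + well_rate - well_rate * t%:R ^+ 2 - u ^+ 2 / (ell ^+ 2 *+ 2).
Proof.
move=> u'a tu; have a0 := spacing_gt0.
have sqr_le x x' y : 0 <= x -> x <= `|x'| -> 0 <= y -> x ^+ 2 / y <= x' ^+ 2 / y.
  move=> x0 xx' y0; rewrite ler_wpM2r ?invr_ge0// -[leRHS]real_normK ?num_real//.
  by rewrite lerXn2r ?nnegrE.
have amgm : W * (`|u| / a) <= u ^+ 2 / (4 * ell ^+ 2) + (W * ell / a) ^+ 2.
  have := sqr_ge0 (`|u| / (2 * ell) - W * ell / a).
  have -> : (`|u| / (2 * ell) - W * ell / a) ^+ 2 =
      `|u| ^+ 2 / (4 * ell ^+ 2) + (W * ell / a) ^+ 2 - W * (`|u| / a).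
    by field; rewrite !gt_eqF.
  by rewrite real_normK ?num_real//; lra.
have gain : well_rate * t%:R ^+ 2 <= u ^+ 2 / (4 * ell ^+ 2).
  have -> : well_rate * t%:R ^+ 2 = (t%:R * a / 2) ^+ 2 / (4 * ell ^+ 2).
    by rewrite /well_rate; field; rewrite gt_eqF.
  apply: sqr_le => //; first by rewrite divr_ge0// mulr_ge0// ltW.
  by rewrite mulr_ge0// sqr_ge0.
have cost : u' ^+ 2 / ell ^+ 2 <= well_rate.
  have -> : well_rate = (a / 4) ^+ 2 / ell ^+ 2.
    by rewrite /well_rate; field; rewrite gt_eqF.
  rewrite -[u' ^+ 2]real_normK ?num_real// ler_wpM2r ?invr_ge0 ?sqr_ge0//.
  by rewrite lerXn2r ?nnegrE// divr_ge0// ltW.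
have -> : u ^+ 2 / (ell ^+ 2 *+ 2) = 2 * (u ^+ 2 / (4 * ell ^+ 2)).
  by rewrite -mulr_natr; field; rewrite gt_eqF.
have -> : (u' ^+ 2 - u ^+ 2) / ell ^+ 2 = u' ^+ 2 / ell ^+ 2 - 4 * (u ^+ 2 / (4 * ell ^+ 2)).
  by field; rewrite gt_eqF.
lra.
Qed.

Lemma crowding_le M k s t x y v : (0 < k <= M)%N -> size v = M ->
  excess_peak M k s t (cells M ((x, y) :: v)) ->
  (2 * p)%:R * (\sum_(w <- v) expR (- (`|x - w.1| / Rad))) <=
  crowding * ((s + 3)%:R + `|x - site a k| / a).
Proof.
move=> kM sv peak; have a0 := spacing_gt0; rewrite /crowding -mulrA ler_wpM2l//.
rewrite -(big_map fst predT (fun x' => expR (- (`|x - x'| / Rad)))).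
apply: (@le_trans _ _ (screening a Rad * (s + 1 + `|cell M x - k|)%:R)).
  apply: sum_expR_dist_le => // c; rewrite -map_comp.
  apply: leq_trans (count_mem_excess_peak c _ (cells_le _ _) kM peak).
    by rewrite /= leq_addl.
  by rewrite /= size_map sv.
apply: ler_wpM2l; first by rewrite ltW// screening_gt0.
rewrite -(ler_pM2r a0) [leRHS]mulrDl divfK ?gt_eqF// !natrD.
have := cell_dist_site a0 x kM; lra.
Qed.

Lemma one_body_pivot_le M k s t x y x' v :
  let c := (below k (cells M v))%:R * a in
  (0 < k <= M)%N -> (0 < t)%N -> size v = M ->
  excess_peak M k s t (cells M ((x, y) :: v)) -> pivot M k (x, y) v -> `|x' - c| <= a / 4 ->
  one_body (x, y) v <=
  expR (exchange_exponent s t) * normal_fun c ell x * one_body_max Rad ell p x' v.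
Proof.
move=> c kM t0 sv peak /andP[side sep] x'c; have a0 := spacing_gt0.
have [xk tx] : `|x - site a k| <= `|x - c| /\ t%:R * a / 2 <= `|x - c|.
  exact: displacement_ge kM t0 (below_overfull_side peak side).
have := one_body_le p Rad0 ell0 y x' sep; rewrite -below_cells -/c => /le_trans; apply.
rewrite ler_wpM2r ?one_body_max_ge0// /normal_fun -expRD ler_expR.
have crowd : (2 * p)%:R * (\sum_(w <- v) expR (- (`|x - w.1| / Rad))) <=
    crowding * (s + 3)%:R + crowding * (`|x - c| / a).
  apply: le_trans (crowding_le kM sv peak) _; rewrite -mulrDr ler_wpM2l ?(ltW crowding_gt0)//.
  by rewrite lerD2l ler_wpM2r ?invr_ge0 ?(ltW a0).
have := well_exponent_le crowding x'c tx; rewrite mulNr /exchange_exponent /=; lra.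
Qed.

End Pivot.

(** * Measurability *)

Lemma measurable_tuple_nat n (A : set (n.-tuple nat)) : measurable A.
Proof.
apply: countable_measurable => [t|]; last exact: countableP.
rewrite (_ : [set t] = \bigcap_(i in [set: 'I_n]) ((@tnth _ nat)^~ i @^-1` [set tnth t i])).
  apply: fin_bigcap_measurable => // i _.
  by rewrite -[X in measurable X]setTI; exact: measurable_tnth.
apply/seteqP; split => [u -> //|u ut]; apply: eq_from_tnth => i; exact: ut.
Qed.

Section MeasurableCount.
Context d (T : measurableType d).

Lemma measurable_count I (s : seq I) (b : I -> T -> bool) :
  (forall i, measurable_fun setT (b i)) -> measurable_fun setT (fun t => count (b^~ t) s).
Proof.
move=> mb; elim: s => [|i s IH] /=; first exact: measurable_cst.
apply: measurable_fun_addn => //.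
rewrite (_ : (fun t => _) = fun t => if b i t then 1%N else 0%N); first exact: measurable_fun_ifT.
by apply/funext => t; case: (b i t).
Qed.

Lemma measurable_natr (R : realType) (b : T -> bool) :
  measurable_fun setT b -> measurable_fun setT (fun t => (b t)%:R : R).
Proof.
move=> mb; rewrite (_ : (fun t => _) = fun t => if b t then 1 else 0 : R).
  exact: measurable_fun_ifT.
by apply/funext => t; case: (b t).
Qed.

End MeasurableCount.

Lemma measurable_all_tuple d d' (T : measurableType d) (Z : measurableType d') n
    (b : T * Z -> bool) :
  measurable_fun setT b ->
  measurable_fun setT (fun w : T * n.-tuple Z => all (fun z => b (w.1, z)) w.2).
Proof.
move=> mb; rewrite (_ : (fun w => _) =
    fun w => count (fun i => b (w.1, tnth w.2 i)) (enum 'I_n) == size (enum 'I_n)).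
  apply: measurable_fun_eqn; last exact: measurable_cst.
  apply: (measurable_count _ (b := fun i w => b (w.1, tnth w.2 i))) => i.
  apply: (measurableT_comp mb); apply: measurable_fun_pair => //.
  exact: measurableT_comp (measurable_tnth i) measurable_snd.
by apply/funext => -[t v] /=; rewrite -all_count -{1}[v : seq _]map_tnth_enum all_map.
Qed.

Section MeasurableLaughlin.
Variables (R : realType) (Rad ell : R) (p : nat).
Local Notation RM := (measurableTypeR R).
Local Notation Z := (RM * RM)%type.

Lemma measurable_cell (a : R) M : measurable_fun setT (cell a M : RM -> nat).
Proof.
apply: (measurable_count _ (b := fun j x => site a j < x)) => j.
exact: measurable_fun_ltr.
Qed.

Lemma measurable_expR_mul_angle (f : R -> R) : continuous f ->
  measurable_fun setT (fun z : Z => expR (z.1 / Rad) * f (z.2 / Rad)).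
Proof.
move=> cf; apply: measurable_funM.
  by apply: measurableT_comp; [exact: measurable_expR|exact: measurable_funM].
apply: measurableT_comp; first exact: continuous_measurable_fun.
exact: measurable_funM.
Qed.

Lemma measurable_sqmod_diff : measurable_fun setT (fun w : Z * Z => sqmod_diff Rad w.1 w.2).
Proof.
have mre : measurable_fun setT (ez_re Rad : Z -> R).
  by apply: measurable_expR_mul_angle; exact: continuous_cos.
have mim : measurable_fun setT (ez_im Rad : Z -> R).
  by apply: measurable_expR_mul_angle; exact: continuous_sin.
by apply: measurable_funD; apply: measurable_funX; apply: measurable_funB;
  (apply: measurableT_comp; [|by [exact: measurable_fst|exact: measurable_snd]]).
Qed.

Lemma measurable_one_body n :
  measurable_fun setT (fun w : Z * n.-tuple Z => one_body Rad ell p w.1 w.2).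
Proof.
have msq i : measurable_fun setT (fun w : Z * n.-tuple Z => sqmod_diff Rad w.1 (tnth w.2 i)).
  have mi : measurable_fun setT (fun w : Z * n.-tuple Z => (w.1, tnth w.2 i)).
    apply: measurable_fun_pair => //.
    exact: measurableT_comp (measurable_tnth i) measurable_snd.
  exact: (measurableT_comp measurable_sqmod_diff mi).
apply: measurable_funM.
  under eq_fun do rewrite big_tuple.
  by apply: measurable_prod => i _; exact: (measurable_funX p (msq i)).
apply: measurableT_comp; first exact: measurable_expR.
apply: measurableT_comp => //; apply: measurable_funM => //; apply: measurable_funX.
exact: measurableT_comp measurable_fst measurable_fst.
Qed.

Lemma measurable_laughlin_sq n :
  measurable_fun setT (fun v : n.-tuple Z => laughlin_sq Rad ell p v).
Proof.
elim: n => [|n IH].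
  rewrite (_ : (fun v => _) = cst (laughlin_sq Rad ell p [::])); first exact: measurable_cst.
  by apply/funext => v; rewrite tuple0.
under eq_fun do rewrite (laughlin_sq_tuple_rem _ _ _ ord0).
apply: measurable_funM; last exact: measurableT_comp IH (measurable_tuple_rem ord0).
exact: (measurableT_comp (@measurable_one_body n) (@measurable_uncons_tuple _ Z n)).
Qed.

Local Notation a := (spacing Rad ell p).

Lemma measurable_cells M n (P : seq nat -> bool) :
  measurable_fun setT (fun v : n.-tuple Z => P (cells Rad ell p M v)).
Proof.
pose f (v : n.-tuple Z) : n.-tuple nat := map_tuple (fun w => cell a M w.1) v.
have mf : measurable_fun setT f.
  apply/measurable_fun_tnthP => i.
  rewrite (_ : _ \o f = fun v => cell a M (tnth v i).1); last first.
    by apply/funext => v /=; rewrite tnth_map.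
  apply: (measurableT_comp (measurable_cell a M)).
  exact: measurableT_comp measurable_fst (measurable_tnth i).
apply: (@measurableT_comp _ _ _ _ _ _ (fun cs : n.-tuple nat => P cs) _ f) => // _ Y mY.
exact: measurable_tuple_nat.
Qed.

Lemma measurable_pivot M k n :
  measurable_fun setT (fun w : Z * n.-tuple Z => pivot Rad ell p M k w.1 w.2).
Proof.
apply: measurable_and.
  exact: (measurableT_comp (@measurable_cells M n.+1
    (fun cs => overfull_side k (head 0%N cs) (behead cs))) (@measurable_cons_tuple _ Z n)).
apply: (measurable_all_tuple (b := fun w : Z * Z =>
  if (cell a M w.2.1 < k)%N then w.2.1 <= w.1.1 else w.1.1 <= w.2.1)).
have m11 : measurable_fun setT (fun w : Z * Z => w.1.1).
  exact: measurableT_comp measurable_fst measurable_fst.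
have m21 : measurable_fun setT (fun w : Z * Z => w.2.1).
  exact: measurableT_comp measurable_fst measurable_snd.
apply: measurable_fun_ifT; [|exact: measurable_fun_ler..].
apply: measurable_fun_ltn; last exact: measurable_cst.
exact: measurableT_comp (measurable_cell a M) m21.
Qed.

End MeasurableLaughlin.

(** * Moving one particle *)

Section CylinderIntegrals.
Variables (R : realType) (Rad ell : R) (p : nat).
Hypotheses (Rad0 : 0 < Rad) (ell0 : 0 < ell).
Local Notation RM := (measurableTypeR R).
Local Notation Z := (RM * RM)%type.
Local Notation mu := (@lebesgue_measure R).

Lemma integral_normal_fun_cylinder (c : R) :
  (\int[cylinder_measure Rad]_z (normal_fun c ell z.1)%:E =
   (2 * pi * Rad / normal_peak ell)%:E)%E.
Proof.
have ell_neq0 : ell != 0 by rewrite gt_eqF.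
have pk0 := normal_peak_gt0 ell_neq0.
rewrite ge0_integral_cylinder_measure; last 2 first.
- apply/measurable_EFinP; apply: measurableT_comp; first exact: measurable_normal_fun.
  exact: measurable_fst.
- by move=> z; rewrite lee_fin normal_fun_ge0.
have mu_angles : mu (angles Rad) = (2 * pi * Rad)%:E.
  by rewrite anglesE lebesgue_measure_itv/= lte_fin period_gt0// -EFinD subr0.
transitivity (\int[mu]_x ((2 * pi * Rad / normal_peak ell)%:E * (normal_pdf c ell x)%:E))%E.
  apply: eq_integral => x _.
  apply: etrans (integral_cst mu (measurable_angles Rad) (normal_fun c ell x)%:E) _.
  rewrite [X in (_ * X)%E]mu_angles -!EFinM normal_pdfE//; congr EFin.
  by field; rewrite gt_eqF.
rewrite ge0_integralZl//.
- by rewrite integral_normal_pdf mule1.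
- by apply/measurable_EFinP; exact: measurable_normal_pdf.
- by move=> x _; rewrite lee_fin normal_pdf_ge0.
- by rewrite lee_fin !mulr_ge0 ?invr_ge0 ?pi_ge0// ltW.
Qed.

Lemma integral_one_body_ge x (v : seq (R * R)) (L : R) : 0 <= L ->
  ((2 * pi * Rad * (one_body_max Rad ell p x v * L))%:E <=
   \int[mu]_(y in angles Rad) (one_body Rad ell p (x, y) v * L)%:E)%E.
Proof.
move=> L0; have gL0 : 0 <= expR (- (x ^+ 2 / ell ^+ 2)) * L by rewrite mulr_ge0 ?expR_ge0.
under eq_integral do rewrite /one_body /= -mulrA mulrC EFinM.
rewrite ge0_integralZl//; last 3 first.
- exact: measurable_angles.
- apply/measurable_EFinP/measurable_funTS; apply: measurable_prod => w _.
  apply: measurable_funX.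
  apply: (measurableT_comp (measurable_sqmod_diff Rad) (g := fun y : RM => ((x, y), w))).
  by apply: measurable_fun_pair => //; exact: measurable_fun_pair.
- by move=> y _; rewrite lee_fin prodr_ge0// => w _; rewrite exprn_ge0// sqmod_diff_ge0.
have -> : 2 * pi * Rad * (one_body_max Rad ell p x v * L) = expR (- (x ^+ 2 / ell ^+ 2)) * L *
    (2 * pi * Rad * \prod_(w <- v) maxexp Rad x w.1 ^+ (2 * p)) by rewrite /one_body_max; ring.
rewrite EFinM lee_wpmul2l//.
exact: integral_prod_sqmod_diff_ge.
Qed.

Lemma integral_window_ge (f : Z -> \bar R) (X : \bar R) (c r K : R) : 0 <= r -> 0 <= K ->
  measurable_fun setT f -> (forall z, 0 <= f z)%E -> (0 <= X)%E ->
  (forall x, (`|x - c| <= r)%R -> X <= K%:E * \int[mu]_(y in angles Rad) f (x, y))%E ->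
  ((2 * r)%:E * X <= K%:E * \int[cylinder_measure Rad]_z f z)%E.
Proof.
move=> r0 K0 mf f0 X0 Xf; pose W : set RM := `[c - r, c + r]%classic.
have mW : measurable W by exact: measurable_itv.
pose g (x : RM) := (\int[mu]_(y in angles Rad) f (x, y))%E.
have g0 x : (0 <= g x)%E by exact: integral_ge0.
have mg : measurable_fun setT g by exact: measurable_integral_angles.
have -> : (2 * r)%:E = mu W.
  rewrite lebesgue_measure_itv/= lte_fin; case: ltP => cr.
    by rewrite -EFinD; congr EFin; ring.
  by congr EFin; lra.
rewrite ge0_integral_cylinder_measure// muleC -(integral_cst mu mW).
apply: (@le_trans _ _ (\int[mu]_(x in W) (K%:E * g x))%E).
  apply: ge0_le_integral => //.
  - by apply: measurable_funTS; exact: measurable_funeM.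
  - move=> x; rewrite /W/= in_itv/= => /andP[cx xc]; apply: Xf.
    by rewrite ler_norml; apply/andP; split; lra.
rewrite ge0_integralZl//; last exact: measurable_funTS.
apply: lee_wpmul2l; first by rewrite lee_fin.
exact: (ge0_subset_integral mu mW measurableT mg (fun x _ => g0 x) (@subsetT _ _)).
Qed.

End CylinderIntegrals.

Section Exchange.
Variables (R : realType) (Rad ell : R) (p : nat).
Hypotheses (Rad0 : 0 < Rad) (ell0 : 0 < ell) (p0 : (0 < p)%N).
Local Notation RM := (measurableTypeR R).
Local Notation Z := (RM * RM)%type.
Local Notation mu := (@lebesgue_measure R).
Local Notation a := (spacing Rad ell p).
Local Notation cell := (cell a).
Local Notation cells := (cells Rad ell p).
Local Notation one_body := (one_body Rad ell p).
Local Notation Lsq := (laughlin_sq Rad ell p).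
Variables (M k s t : nat).
Hypothesis kM : (0 < k <= M)%N.
Implicit Types (z : R * R) (v : seq (R * R)).

(* After the move the particle is in cell [k + t] if it started left of site [k],
   and in cell [k - t.+1] if it started right of it. *)
Definition landing c := ((c == k + t) || (c + t.+1 == k))%N.

Definition source z v : R :=
  (excess_peak M k s t.+1 (cells M (z :: v)) && pivot Rad ell p M k z v)%:R *
  (one_body z v * Lsq v).

Definition target z v : R :=
  (excess_peak M k s.+1 t (cells M (z :: v)) && landing (cell M z.1))%:R *
  (one_body z v * Lsq v).

Lemma source_ge0 z v : 0 <= source z v.
Proof. by rewrite mulr_ge0// mulr_ge0 ?one_body_ge0 ?laughlin_sq_ge0. Qed.

Lemma target_ge0 z v : 0 <= target z v.
Proof. by rewrite mulr_ge0// mulr_ge0 ?one_body_ge0 ?laughlin_sq_ge0. Qed.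

Lemma measurable_weight n (b : Z * n.-tuple Z -> bool) : measurable_fun setT b ->
  measurable_fun setT (fun w : Z * n.-tuple Z => (b w)%:R * (one_body w.1 w.2 * Lsq w.2)).
Proof.
move=> mb; apply: measurable_funM; first exact: measurable_natr.
apply: measurable_funM; first exact: measurable_one_body.
exact: (measurableT_comp (@measurable_laughlin_sq _ Rad ell p n) measurable_snd).
Qed.

Lemma measurable_source n : measurable_fun setT (fun w : Z * n.-tuple Z => source w.1 w.2).
Proof.
apply: measurable_weight; apply: measurable_and; last exact: measurable_pivot.
exact: (measurableT_comp (@measurable_cells _ Rad ell p M n.+1 (excess_peak M k s t.+1))
  (@measurable_cons_tuple _ Z n)).
Qed.

Lemma measurable_target n : measurable_fun setT (fun w : Z * n.-tuple Z => target w.1 w.2).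
Proof.
apply: measurable_weight.
exact: (measurableT_comp (@measurable_cells _ Rad ell p M n.+1
  (fun cs => excess_peak M k s.+1 t cs && landing (head 0%N cs))) (@measurable_cons_tuple _ Z n)).
Qed.

Lemma target_window z v x y : size v = M ->
  excess_peak M k s t.+1 (cells M (z :: v)) -> pivot Rad ell p M k z v ->
  `|x - (below k (cells M v))%:R * a| <= a / 4 ->
  target (x, y) v = one_body (x, y) v * Lsq v.
Proof.
rewrite cells_cons => sv peak /andP[side _] xL; rewrite /target cells_cons.
have LM : (below k (cells M v) <= M)%N.
  by have := below_le_size k (cells M v); rewrite size_map sv.
rewrite (cell_window (spacing_gt0 Rad0 ell0 p0) LM xL) (excess_peak_move peak side) /landing.
have := below_overfull_side peak side; rewrite addnS subn1 /=.
by case/orP => /andP[_ ->]; rewrite ?orbT mul1r.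
Qed.

Lemma source_le x y x' v : size v = M ->
  let c := (below k (cells M v))%:R * a in `|x' - c| <= a / 4 ->
  source (x, y) v <=
  expR (exchange_exponent Rad ell p s t.+1) * one_body_max Rad ell p x' v * Lsq v *
  normal_fun c ell x.
Proof.
move=> sv c x'c; rewrite /source; case: andP => [[peak piv]|_]; last first.
  rewrite mul0r mulr_ge0 ?normal_fun_ge0// mulr_ge0 ?laughlin_sq_ge0//.
  by rewrite mulr_ge0 ?expR_ge0 ?one_body_max_ge0.
rewrite mul1r [leRHS]mulrAC ler_wpM2r ?laughlin_sq_ge0// [leRHS]mulrAC.
exact: one_body_pivot_le.
Qed.

Lemma integral_source_le (v : M.-tuple Z) x : `|x - (below k (cells M v))%:R * a| <= a / 4 ->
  (\int[cylinder_measure Rad]_z (source z v)%:E <=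
   (expR (exchange_exponent Rad ell p s t.+1) / normal_peak ell)%:E *
   \int[mu]_(y in angles Rad) (one_body (x, y) v * Lsq v)%:E)%E.
Proof.
set c := _%:R * a => xc; set E := expR _.
have pk0 : 0 < normal_peak ell by rewrite normal_peak_gt0 ?gt_eqF.
pose K := E * one_body_max Rad ell p x v * Lsq v.
have K0 : 0 <= K by rewrite mulr_ge0 ?laughlin_sq_ge0// mulr_ge0 ?expR_ge0 ?one_body_max_ge0.
have mG : measurable_fun setT (fun z : Z => (normal_fun c ell z.1)%:E).
  apply/measurable_EFinP; apply: measurableT_comp; first exact: measurable_normal_fun.
  exact: measurable_fst.
apply: (@le_trans _ _ (\int[cylinder_measure Rad]_z (K%:E * (normal_fun c ell z.1)%:E))%E).
  apply: ge0_le_integral => //.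
  - by move=> z _; rewrite lee_fin source_ge0.
  - apply/measurable_EFinP.
    exact: (measurableT_comp (@measurable_source M) (measurable_pair2 v)).
  - exact: measurable_funeM.
  - by move=> [x' y'] _; rewrite -EFinM lee_fin; apply: source_le; rewrite ?size_tuple.
rewrite ge0_integralZl//; last by move=> z _; rewrite lee_fin normal_fun_ge0.
rewrite integral_normal_fun_cylinder//.
apply: (@le_trans _ _ ((E / normal_peak ell)%:E *
    (2 * pi * Rad * (one_body_max Rad ell p x v * Lsq v))%:E)%E).
  rewrite -!EFinM lee_fin le_eqVlt; apply/predU1P; left.
  by rewrite /K; field; rewrite gt_eqF.
apply: lee_wpmul2l; first by rewrite lee_fin divr_ge0 ?expR_ge0// ltW.
by apply: integral_one_body_ge => //; exact: laughlin_sq_ge0.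
Qed.

Definition exchange_factor : R :=
  expR (exchange_exponent Rad ell p s t.+1) / normal_peak ell * (2 / a).

Lemma exchange_factor_gt0 : 0 < exchange_factor.
Proof.
have a0 := spacing_gt0 Rad0 ell0 p0.
by apply: mulr_gt0; apply: divr_gt0; rewrite ?expR_gt0 ?normal_peak_gt0 ?gt_eqF.
Qed.

Lemma integral_exchange (v : M.-tuple Z) :
  (\int[cylinder_measure Rad]_z (source z v)%:E <=
   exchange_factor%:E * \int[cylinder_measure Rad]_z (target z v)%:E)%E.
Proof.
have a0 := spacing_gt0 Rad0 ell0 p0.
have msrc : measurable_fun setT (fun z : Z => (source z v)%:E).
  by apply/measurable_EFinP; exact: (measurableT_comp (@measurable_source M) (measurable_pair2 v)).
have mtgt : measurable_fun setT (fun z : Z => (target z v)%:E).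
  by apply/measurable_EFinP; exact: (measurableT_comp (@measurable_target M) (measurable_pair2 v)).
have src0 z : (0 <= (source z v)%:E)%E by rewrite lee_fin source_ge0.
have tgt0 z : (0 <= (target z v)%:E)%E by rewrite lee_fin target_ge0.
have [[z0 z0_src]|no_src] := pselect (exists z, source z v != 0); last first.
  rewrite integral0_eq; first by rewrite mule_ge0 ?integral_ge0// lee_fin ltW ?exchange_factor_gt0.
  by move=> z _; congr EFin; apply/eqP/negPn/negP => zv; apply: no_src; exists z.
have [peak piv] : excess_peak M k s t.+1 (cells M (z0 :: v)) /\ pivot Rad ell p M k z0 v.
  by move: z0_src; rewrite /source; case: andP => //; rewrite mul0r eqxx.
have G0 : 0 <= expR (exchange_exponent Rad ell p s t.+1) / normal_peak ell.
  by rewrite divr_ge0 ?expR_ge0 ?normal_peak_ge0.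
have r0 : 0 <= a / 4 by rewrite divr_ge0// ltW.
have window : ((2 * (a / 4))%:E * \int[cylinder_measure Rad]_z (source z v)%:E <=
    (expR (exchange_exponent Rad ell p s t.+1) / normal_peak ell)%:E *
    \int[cylinder_measure Rad]_z (target z v)%:E)%E.
  apply: (integral_window_ge (c := (below k (cells M v))%:R * a) r0 G0 mtgt tgt0) => [|x xc].
    exact: integral_ge0.
  under [X in (_ <= _ * X)%E]eq_integral do rewrite (target_window _ (size_tuple v) peak piv xc).
  exact: integral_source_le.
rewrite /exchange_factor mulrC EFinM -muleA (_ : 2 / a = (2 * (a / 4))^-1); last first.
  by field; rewrite gt_eqF.
by rewrite lee_pdivlMl// mulr_gt0// divr_gt0.
Qed.

End Exchange.

Section Configurations.
Variables (R : realType) (Rad ell : R) (p : nat).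
Implicit Types (M k s t : nat).
Local Notation a := (spacing Rad ell p).
Local Notation cell := (cell a).
Local Notation cells := (cells Rad ell p).
Local Notation Lsq := (laughlin_sq Rad ell p).
Local Notation Z := (R * R)%type.

Lemma perm_cells M (u v : seq Z) : perm_eq u v -> perm_eq (cells M u) (cells M v).
Proof. exact: perm_map. Qed.

Lemma pivot_exists M k s t (u : M.+1.-tuple Z) : (k <= M)%N ->
  excess_peak M k s t.+1 (cells M u) ->
  exists j, pivot Rad ell p M k (tnth u j) (tuple_rem j u).
Proof.
move=> kM /excess_peakP[ht _]; pose x i := (tnth u i).1.
have belowE j : below k (cell M (x j) :: cells M (tuple_rem j u)) = below k (cells M u).
  by rewrite -cells_cons; apply/perm_below/perm_cells; rewrite perm_sym perm_tuple_rem.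
have cellP (P : pred nat) : has P (cells M u) -> exists i, P (cell M (x i)).
  by move=> /hasP[c /mapP[w /tnthP[i ->] ->] Pc]; exists i.
have sep j : (forall i, if (cell M (x i) < k)%N then x i <= x j else x j <= x i) ->
    separates (fun w => cell M w.1 < k)%N (x j) (tuple_rem j u).
  by move=> xj; apply/all_tnthP => i; rewrite tnth_mktuple; exact: xj.
have [bk|bk] := ltnP k (below k (cells M u)).
  have [|i0 Pi0] := cellP (fun c => c < k)%N; first by rewrite has_count; exact: leq_ltn_trans bk.
  have [j Pj jmax] := @arg_maxP _ _ _ i0 (fun i => cell M (x i) < k)%N x Pi0.
  exists j; rewrite /pivot /overfull_side belowE Pj bk /= sep// => i.
  by case: ltnP => [/jmax//|ki]; apply/ltW/(@lt_cell _ a M)/(leq_trans Pj).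
have {}bk : (below k (cells M u) < k)%N by rewrite /excess in ht; lia.
have [|i0 Pi0] := cellP (fun c => k <= c)%N.
  apply: contraTT (bk) => /hasPn cells_lt; rewrite -leqNgt below_eq_size.
    by rewrite size_map size_tuple leqW.
  by apply/allP => c /cells_lt; rewrite -ltnNge.
have [j Pj jmin] := @arg_minP _ _ _ i0 (fun i => k <= cell M (x i))%N x Pi0.
exists j; rewrite /pivot /overfull_side belowE Pj bk orbT sep// => i.
by case: ltnP => [ik|/jmin//]; apply/ltW/(@lt_cell _ a M)/(leq_trans ik).
Qed.

Definition excess_weight M k s t (u : seq Z) : R := (excess_peak M k s t (cells M u))%:R * Lsq u.

Lemma perm_cells_tuple_rem M j (u : M.+1.-tuple Z) :
  perm_eq (cells M u) (cells M (tnth u j :: tuple_rem j u)).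
Proof. exact/perm_cells/perm_tuple_rem. Qed.

Lemma excess_weight_le_sum_source M k s t (u : M.+1.-tuple Z) : (k <= M)%N ->
  excess_weight M k s t.+1 u <=
  \sum_(j < M.+1) source Rad ell p M k s t (tnth u j) (tuple_rem j u).
Proof.
move=> kM; rewrite /excess_weight.
have src0 j : 0 <= source Rad ell p M k s t (tnth u j) (tuple_rem j u) by exact: source_ge0.
case peak: (excess_peak _ _ _ _ _); last by rewrite mul0r sumr_ge0.
have [j piv] := pivot_exists kM peak; rewrite (bigD1 j)//= ler_wpDr ?sumr_ge0//.
by rewrite /source -(perm_excess_peak _ _ _ _ (perm_cells_tuple_rem j u)) peak piv
  -laughlin_sq_tuple_rem.
Qed.

Lemma sum_landing_le M k s t (u : M.+1.-tuple Z) : (0 < k <= M)%N ->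
  excess_peak M k s.+1 t (cells M u) ->
  (\sum_(j < M.+1) landing k t (cell M (tnth u j).1) <= 4 * (s + t + 3))%N.
Proof.
move=> kM peak; have -> : (\sum_(j < M.+1) landing k t (cell M (tnth u j).1) =
    count (landing k t) (cells M u))%N.
  by rewrite -sum1_count big_map [RHS]big_mkcond big_tuple; apply: eq_bigr => j _; case: landing.
apply: (@leq_trans (count_mem (k + t) (cells M u) + count_mem (k - t.+1) (cells M u))%N).
  rewrite -count_predUI; apply: leq_trans (leq_addr _ _); apply: sub_count => c.
  by rewrite /landing /=; lia.
have occ c : (count_mem c (cells M u) <= 2 * (s.+1 + 1 + `|c - k|))%N.
  by apply: count_mem_excess_peak peak => //; [rewrite size_map size_tuple|exact: cells_le].
by have := occ (k + t)%N; have := occ (k - t.+1)%N; lia.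
Qed.

Lemma sum_target_le_excess_weight M k s t (u : M.+1.-tuple Z) : (0 < k <= M)%N ->
  \sum_(j < M.+1) target Rad ell p M k s t (tnth u j) (tuple_rem j u) <=
  (4 * (s + t + 3))%:R * excess_weight M k s.+1 t u.
Proof.
move=> kM; rewrite /excess_weight; case peak: (excess_peak _ _ _ _ _); last first.
  rewrite mul0r mulr0 big1// => j _.
  by rewrite /target -(perm_excess_peak _ _ _ _ (perm_cells_tuple_rem j u)) peak mul0r.
rewrite mul1r (eq_bigr (fun j => (landing k t (cell M (tnth u j).1))%:R * Lsq u)).
  rewrite -mulr_suml -natr_sum ler_wpM2r ?laughlin_sq_ge0// ler_nat.
  exact: sum_landing_le peak.
by move=> j _; rewrite /target -(perm_excess_peak _ _ _ _ (perm_cells_tuple_rem j u)) peak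
  -laughlin_sq_tuple_rem.
Qed.

End Configurations.

(** * Iteration and union bound *)

Section Mass.
Variables (R : realType) (Rad ell : R) (p M : nat).
Local Notation RM := (measurableTypeR R).
Local Notation Z := (RM * RM)%type.
Local Notation cells := (cells Rad ell p M).
Local Notation Lsq := (laughlin_sq Rad ell p).
Local Notation nu := (cylinder_measure Rad).
Implicit Types P : seq nat -> bool.

Definition mass P : \bar R :=
  (\int[tuple_measure nu M.+1]_u ((P (cells u))%:R * Lsq u)%:E)%E.

Lemma measurable_mass P n :
  measurable_fun setT (fun u : n.-tuple Z => ((P (cells u))%:R * Lsq u)%:E).
Proof.
apply/measurable_EFinP; apply: measurable_funM; last exact: measurable_laughlin_sq.
by apply: measurable_natr; exact: measurable_cells.
Qed.

Lemma mass_integrand_ge0 P u : (0 <= ((P (cells u))%:R * Lsq u)%:E)%E.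
Proof. by rewrite lee_fin mulr_ge0// laughlin_sq_ge0. Qed.

Lemma mass_ge0 P : (0 <= mass P)%E.
Proof. by apply: integral_ge0 => u _; exact: mass_integrand_ge0. Qed.

Lemma le_mass_sum I (r : seq I) P (Q : I -> seq nat -> bool) :
  (forall cs, size cs = M.+1 -> P cs -> has (Q^~ cs) r) ->
  (mass P <= \sum_(i <- r) mass (Q i))%E.
Proof.
move=> PQ; rewrite -ge0_integral_sum//; last 2 first.
- by move=> i; exact: measurable_mass.
- by move=> i u _; exact: mass_integrand_ge0.
apply: ge0_le_integral => //.
- by move=> u _; exact: mass_integrand_ge0.
- exact: measurable_mass.
- by apply: emeasurable_sum => i; exact: measurable_mass.
move=> u _; rewrite sumEFin lee_fin -mulr_suml ler_wpM2r ?laughlin_sq_ge0//.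
have -> : \sum_(i <- r) (Q i (cells u))%:R = (count (Q^~ (cells u)) r)%:R :> R.
  by rewrite -natr_sum -sum1_count [in RHS]big_mkcond.
rewrite ler_nat; case Pu: (P _) => //.
by rewrite -has_count PQ ?size_map ?size_tuple.
Qed.

Lemma PN_mass (E : seq (R * R) -> bool) P : E =1 (fun u => P (cells u)) ->
  PN Rad ell p M.+1 E = fine (mass P) / fine (mass predT).
Proof.
move=> EP; rewrite /PN !(@cyl_intE _ _ M.+1); last 4 first.
- by apply/measurable_EFinP; exact: measurable_laughlin_sq.
- by move=> u; rewrite lee_fin laughlin_sq_ge0.
- by under eq_fun do rewrite EP; exact: measurable_mass.
- by move=> u; rewrite EP mass_integrand_ge0.
congr (fine _ / fine _); apply: eq_integral => u _; first by rewrite EP.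
by rewrite mul1r.
Qed.

End Mass.

Lemma ler_fine_div (R : realType) (x y : \bar R) (C : R) : 0 <= C ->
  (0 <= x)%E -> (0 <= y)%E -> (x <= C%:E * y)%E -> fine x / fine y <= C.
Proof.
case: x y => [x| |] [y| |] //= C0 x0 y0; rewrite ?invr0 ?mulr0 ?mul0r//.
rewrite -EFinM lee_fin => xCy; move: y0; rewrite lee_fin le_eqVlt => /predU1P[<-|y0].
  by rewrite invr0 mulr0.
by rewrite ler_pdivrMr.
Qed.

Section Tail.
Variables (R : realType) (Rad ell : R) (p : nat).
Implicit Types (M k s t n m : nat).
Local Notation RM := (measurableTypeR R).
Local Notation Z := (RM * RM)%type.
Local Notation a := (spacing Rad ell p).
Local Notation crowding := (crowding Rad ell p).
Local Notation well_rate := (well_rate Rad ell p).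
Local Notation mass := (mass Rad ell p).
Local Notation nu := (cylinder_measure Rad).
Local Notation exchange_factor := (exchange_factor Rad ell p).

Lemma mass_excess_peak_le_source M k s t : (k <= M)%N ->
  (mass M (excess_peak M k s t.+1) <= M.+1%:R%:E *
   \int[tuple_measure nu M]_v \int[nu]_z (source Rad ell p M k s t z v)%:E)%E.
Proof.
move=> kM; pose src (w : Z * M.-tuple Z) := (source Rad ell p M k s t w.1 w.2)%:E.
have src0 w : (0 <= src w)%E by rewrite lee_fin source_ge0.
have msrc : measurable_fun setT src by apply/measurable_EFinP; exact: measurable_source.
rewrite -(ge0_integral_tuple_measure_sum_pick _ msrc src0); apply: ge0_le_integral => //.
- by move=> u _; exact: mass_integrand_ge0.
- exact: measurable_mass.
- by apply: emeasurable_sum => j; exact: measurable_pick.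
by move=> u _; rewrite sumEFin lee_fin; exact: excess_weight_le_sum_source.
Qed.

Lemma target_le_mass_excess_peak M k s t : (0 < k <= M)%N ->
  (M.+1%:R%:E * (\int[tuple_measure nu M]_v \int[nu]_z (target Rad ell p M k s t z v)%:E) <=
   (4 * (s + t + 3))%:R%:E * mass M (excess_peak M k s.+1 t))%E.
Proof.
move=> kM; pose tgt (w : Z * M.-tuple Z) := (target Rad ell p M k s t w.1 w.2)%:E.
have tgt0 w : (0 <= tgt w)%E by rewrite lee_fin target_ge0.
have mtgt : measurable_fun setT tgt by apply/measurable_EFinP; exact: measurable_target.
rewrite -(ge0_integral_tuple_measure_sum_pick _ mtgt tgt0) -ge0_integralZl//; last 2 first.
- exact: measurable_mass.
- by move=> u _; exact: mass_integrand_ge0.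
apply: ge0_le_integral => //.
- by move=> u _; apply: sume_ge0.
- by apply: emeasurable_sum => j; exact: measurable_pick.
- by apply: measurable_funeM; exact: measurable_mass.
by move=> u _; rewrite sumEFin lee_fin; exact: sum_target_le_excess_weight.
Qed.

Hypotheses (Rad0 : 0 < Rad) (ell0 : 0 < ell) (p0 : (0 < p)%N).

Lemma mass_excess_peak_exchange M k s t : (0 < k <= M)%N ->
  (mass M (excess_peak M k s t.+1) <=
   (exchange_factor s t * (4 * (s + t + 3))%:R)%:E * mass M (excess_peak M k s.+1 t))%E.
Proof.
move=> kM; have [_ kleM] := andP kM.
have q0 : (0 <= (exchange_factor s t)%:E)%E by rewrite lee_fin ltW ?exchange_factor_gt0.
apply: (le_trans (mass_excess_peak_le_source s t kleM)).
rewrite EFinM -muleA.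
apply: le_trans (lee_wpmul2l q0 (target_le_mass_excess_peak s t kM)).
rewrite muleCA; apply: lee_wpmul2l => //.
have minner (f : Z -> M.-tuple Z -> R) :
    measurable_fun setT (fun w : Z * M.-tuple Z => f w.1 w.2) -> (forall z v, 0 <= f z v) ->
    measurable_fun setT (fun v => \int[nu]_z (f z v)%:E)%E.
  move=> mf f0; apply: (measurable_fun_fubini_tonelli_G (fun w => (f w.1 w.2)%:E)) => [|w].
    exact/measurable_EFinP.
  by rewrite lee_fin.
have mtgt := minner _ (@measurable_target _ Rad ell p M k s t M)
  (fun z v => target_ge0 Rad ell p M k s t z v).
rewrite -ge0_integralZl//; last first.
  by move=> v _; apply: integral_ge0 => z _; rewrite lee_fin target_ge0.
apply: ge0_le_integral => //.
- by move=> v _; apply: integral_ge0 => z _; rewrite lee_fin source_ge0.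
- by apply: minner => [|z v]; [exact: measurable_source|exact: source_ge0].
- exact: measurable_funeM.
by move=> v _; exact: integral_exchange.
Qed.

Definition entropy : R :=
  2 * crowding + 2 + (crowding * ell / a) ^+ 2 + well_rate + 8 / (normal_peak ell * a).

Lemma entropy_gt0 : 0 < entropy.
Proof.
have pk0 : 0 < normal_peak ell by rewrite normal_peak_gt0 ?gt_eqF.
have : 0 < 8 / (normal_peak ell * a) by rewrite divr_gt0// mulr_gt0// spacing_gt0.
have := crowding_gt0 Rad0 ell0 p0; have := well_rate_gt0 Rad0 ell0 p0.
have := sqr_ge0 (crowding * ell / a); rewrite /entropy; lra.
Qed.

Lemma exchange_factor_le s t : exchange_factor s t * (4 * (s + t + 3))%:R <=
  expR (entropy * (s + t + 2)%:R - well_rate * t.+1%:R ^+ 2).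
Proof.
have a0 := spacing_gt0 Rad0 ell0 p0.
have pk0 : 0 < normal_peak ell by rewrite normal_peak_gt0 ?gt_eqF.
have w0 := crowding_gt0 Rad0 ell0 p0; have r0 := well_rate_gt0 Rad0 ell0 p0.
set B := 8 / (normal_peak ell * a).
have B0 : 0 < B by rewrite divr_gt0// mulr_gt0.
have -> : exchange_factor s t * (4 * (s + t + 3))%:R =
    expR (exchange_exponent Rad ell p s t.+1) * (B * (s + t + 3)%:R).
  by rewrite /exchange_factor /B natrM; field; rewrite !gt_eqF.
have lt_expR (x : R) : x <= expR x by rewrite (le_trans _ (expR_ge1Dx _))// lerDr.
apply: (@le_trans _ _ (expR (exchange_exponent Rad ell p s t.+1) *
    (expR B * expR (s + t + 3)%:R))).
  by rewrite ler_wpM2l ?expR_ge0// ler_pM// ltW.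
rewrite -!expRD ler_expR /exchange_exponent /entropy -/B !natrD.
set Q := (crowding * ell / a) ^+ 2; have Q0 : 0 <= Q by exact: sqr_ge0.
have s0 : 0 <= s%:R :> R by []; have t0 : 0 <= t%:R :> R by [].
nra.
Qed.

Lemma mass_excess_peak_iter M k s t : (0 < k <= M)%N ->
  (mass M (excess_peak M k s t) <=
   (expR (entropy * (t * (s + t + 1))%:R - well_rate * (t%:R ^+ 3 / 3)))%:E * mass M predT)%E.
Proof.
move=> kM; elim: t s => [|t IH] s.
  rewrite mul0n expr0n /= mul0r !mulr0 subr0 expR0 mul1e.
  by have := @le_mass_sum _ Rad ell p M _ [:: tt] (excess_peak M k s 0) (fun=> predT);
    rewrite big_seq1; apply.
apply: (le_trans (mass_excess_peak_exchange s t kM)).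
have F0 : (0 <= (exchange_factor s t * (4 * (s + t + 3))%:R)%:E)%E.
  by rewrite lee_fin mulr_ge0// ltW// exchange_factor_gt0.
apply: (le_trans (lee_wpmul2l F0 (IH s.+1))).
rewrite muleA -EFinM; apply: lee_wpmul2r; first exact: mass_ge0.
rewrite lee_fin.
apply: le_trans (ler_wpM2r (expR_ge0 _) (exchange_factor_le s t)) _.
rewrite -expRD ler_expR.
have r0 := well_rate_gt0 Rad0 ell0 p0; have t0 : 0 <= t%:R :> R by [].
have cube : well_rate * (t.+1%:R ^+ 3 / 3) <= well_rate * (t.+1%:R ^+ 2 + t%:R ^+ 3 / 3).
  by rewrite ler_wpM2l ?(ltW r0)// -natr1; nra.
have -> : (t.+1 * (s + t.+1 + 1) = (s + t + 2) + t * (s.+1 + t + 1))%N by lia.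
rewrite natrD; nra.
Qed.

Definition tail_rate : R := well_rate / 6.

Definition tail_exponent : R := 3 * entropy * (3 * entropy / tail_rate) ^+ 2.

Lemma tail_rate_gt0 : 0 < tail_rate.
Proof. by rewrite divr_gt0// well_rate_gt0. Qed.

Lemma mass_excess_peak_le M k m : (0 < k <= M)%N ->
  (mass M (excess_peak M k m m) <=
   (expR tail_exponent * expR (- (tail_rate * m%:R ^+ 3)))%:E * mass M predT)%E.
Proof.
move=> kM; apply: le_trans (mass_excess_peak_iter m m kM) _.
apply: lee_wpmul2r; first exact: mass_ge0.
have r0 := tail_rate_gt0; have e0 := entropy_gt0.
set b := 3 * entropy; have b0 : 0 < b by rewrite mulr_gt0.
have linear : entropy * (m * (m + m + 1))%:R <= b * m%:R ^+ 2.
  by rewrite /b -mulrA mulrCA ler_wpM2l ?(ltW e0)// -natrX -natrM ler_nat; nia.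
have quadratic : b * m%:R ^+ 2 <= tail_exponent + tail_rate * m%:R ^+ 3 by exact: sqr_le_cube.
rewrite lee_fin -expRD ler_expR (_ : well_rate = 6 * tail_rate); last by rewrite /tail_rate; field.
lra.
Qed.

Definition tail_const : R := 2 * expR tail_exponent * (1 - expR (- tail_rate)) ^- 2.

Lemma tail_const_gt0 : 0 < tail_const.
Proof.
rewrite mulr_gt0 ?mulr_gt0 ?expR_gt0// invr_gt0 exprn_gt0// subr_gt0 expR_lt1 oppr_lt0.
exact: tail_rate_gt0.
Qed.

Lemma mass_excess_tail M k n : (0 < k <= M)%N ->
  (mass M (fun cs => n <= excess k cs)%N <=
   (tail_const * expR (- (tail_rate * n%:R ^+ 3)))%:E * mass M predT)%E.
Proof.
move=> kM; have [k0 _] := andP kM.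
pose m (ji : 'I_M * 'I_M.+2) := (n + `|ji.1.+1 - k| + ji.2)%N.
apply: (@le_trans _ _ (\sum_(ji : 'I_M * 'I_M.+2)
    mass M (excess_peak M ji.1.+1 (m ji) (m ji)))%E).
  apply: le_mass_sum => cs sz /(excess_peak_exists sz kM)[[//|j] jM [i iM peak]].
  by apply/hasP; exists (Ordinal (jM : j < M)%N, Ordinal iM); rewrite ?mem_index_enum.
apply: (@le_trans _ _ (\sum_(ji : 'I_M * 'I_M.+2)
    (expR tail_exponent * expR (- (tail_rate * (m ji)%:R ^+ 3)))%:E * mass M predT)%E).
  by apply: lee_sum => ji _; apply: mass_excess_peak_le; rewrite ltn_ord.
rewrite -ge0_sume_distrl => [|ji _]; last by rewrite lee_fin mulr_ge0 ?expR_ge0.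
apply: lee_wpmul2r; first exact: mass_ge0.
rewrite sumEFin lee_fin -mulr_sumr.
rewrite -(pair_bigA _ (fun j i => expR (- (tail_rate * (m (j, i))%:R ^+ 3)))).
set X := expR (- _); have -> : tail_const * X =
    expR tail_exponent * (2 * (1 - expR (- tail_rate)) ^- 2 * X) by rewrite /tail_const; ring.
rewrite ler_wpM2l ?expR_ge0//.
exact: sum_expR_cube_le tail_rate_gt0 k0.
Qed.

End Tail.

Theorem theorem5p4 (R : realType) (Rad ell : R) (p : nat) :
  0 < Rad -> 0 < ell -> (0 < p)%N ->
  exists C c : R, 0 < C /\ 0 < c /\
    forall N k n : nat, (2 <= N)%N -> (1 <= k <= N.-1)%N ->
      PN Rad ell p N
        (fun z => (n%:Z <= `|Kexcess (xbar Rad ell p k) k z|)%R)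
      <= C * expR (- (c * n%:R ^+ 3)).
Proof.
move=> Rad0 ell0 p0; have C0 := tail_const_gt0 Rad0 ell0 p0.
exists (tail_const Rad ell p), (tail_rate Rad ell p).
split=> //; split; first exact: tail_rate_gt0.
move=> [//|M] k n _ kM.
rewrite (@PN_mass _ _ _ _ _ _ (fun cs => n <= excess k cs)%N); last first.
  by move=> z; rewrite (Kexcess_cells Rad0 ell0 p0 z kM).
apply: ler_fine_div; [|exact: mass_ge0..|exact: mass_excess_tail].
by rewrite mulr_ge0 ?expR_ge0// ltW.
Qed.
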